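(* Let $l$ be a prime and let $F$ be a field with $\mathrm{char}(F)\neq l$ and $\boldsymbol{\mu}_{l^\infty}\subset F$. Fix a separable closure $F^{sep}$ of $F$. Let $\widehat{F^*}:=\varprojlim_n F^*/(F^* )^{l^n}$ and $V:=\mathbb{Q}_l\otimes_{\mathbb{Z}_l}\widehat{F^*}$. Then the set of $\mathbb{Z}_l^d$-extensions of $F$ contained in $F^{sep}$ is in bijection with $\mathrm{Grass}_d(V)$.
   Context: $\boldsymbol{\mu}_{l^\infty}$ is the group of all roots of unity of $l$-power order. A $\mathbb{Z}_l^d$-extension of $F$ is a Galois extension with Galois group isomorphic to $\mathbb{Z}_l^d$. $\mathrm{Grass}_d(V)$ is the set of all $d$-dimensional $\mathbb{Q}_l$-subspaces of $V$. *)

(* Defs.v *)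
From HB Require Import structures.
From mathcomp Require Import all_boot all_order all_algebra generic_quotient.
From mathcomp Require Import ring_quotient separable.
From mathcomp Require Import freeg.
From mathcomp Require Import boolp classical_sets functions topology.

Set Implicit Arguments.
Unset Strict Implicit.
Unset Printing Implicit Defensive.

Import Order.TTheory GRing.Theory Num.Theory.
Import Quotient.Exports.

Local Open Scope classical_set_scope.
Local Open Scope ring_scope.
Local Open Scope quotient_scope.

Section PadicInt.
Variable l : nat.

(* An element of Z_l = lim_n Z/l^n.  The class modulo l^n is given by its
   canonical representative: [padicP] states at once that [res n] lies in
   [0, l^n) and that [res n.+1] = [res n] modulo l^n.  The index n = 0 is
   harmless, since Z/l^0 is trivial.  The primality proof is a parameter of
   the type because the ring structure needs it. *)
Record padic_int (lP : prime l) := PadicInt {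
  res :> nat -> int;
  padicP : forall n, res n = (res n.+1 %% (l ^ n)%N)%Z }.

Variable lP : prime l.
Local Notation Zl := (padic_int lP).

HB.instance Definition _ := gen_eqMixin Zl.
HB.instance Definition _ := gen_choiceMixin Zl.

Implicit Types a b c : Zl.

Let q n : int := (l ^ n)%N.

Lemma padic_ext a b : (forall n, a n = b n) -> a = b.
Proof.
case: a b => [f fP] [g gP] /= /funext e; subst g.
by congr PadicInt; exact: Prop_irrelevance.
Qed.

Let red n (x : int) : int := (x %% q n)%Z.

Lemma padic_redS n x : red n (red n.+1 x) = red n x.
Proof.
rewrite /red [in RHS](divz_eq x (q n.+1)) /q expnSr PoszM mulrA mulrAC.
by rewrite modzMDl.
Qed.

Lemma res_red a n : red n (a n) = a n.
Proof. by rewrite /red padicP modz_mod. Qed.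

Lemma res_redS a n : red n (a n.+1) = a n.
Proof. by rewrite [RHS]padicP. Qed.

Fact padic_constP (x : int) n : red n x = red n (red n.+1 x).
Proof. by rewrite padic_redS. Qed.

Definition padic_const x := PadicInt lP (padic_constP x).

Fact padic_oppP a n : red n (- a n) = red n (red n.+1 (- a n.+1)).
Proof. by rewrite padic_redS -(res_redS a n) /red modzNm. Qed.

Definition padic_opp a := PadicInt lP (padic_oppP a).

Fact padic_addP a b n :
  red n (a n + b n) = red n (red n.+1 (a n.+1 + b n.+1)).
Proof. by rewrite padic_redS -(res_redS a n) -(res_redS b n) /red modzDm. Qed.

Definition padic_add a b := PadicInt lP (padic_addP a b).

Fact padic_mulP a b n :
  red n (a n * b n) = red n (red n.+1 (a n.+1 * b n.+1)).
Proof. by rewrite padic_redS -(res_redS a n) -(res_redS b n) /red modzMm. Qed.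

Definition padic_mul a b := PadicInt lP (padic_mulP a b).

Fact padic_addA : associative padic_add.
Proof.
by move=> a b c; apply: padic_ext => n /=; rewrite /red modzDmr modzDml addrA.
Qed.

Fact padic_addC : commutative padic_add.
Proof. by move=> a b; apply: padic_ext => n /=; rewrite addrC. Qed.

Fact padic_add0 : left_id (padic_const 0) padic_add.
Proof.
by move=> a; apply: padic_ext => n /=; rewrite /red mod0z add0r; exact: res_red.
Qed.

Fact padic_addN : left_inverse (padic_const 0) padic_opp padic_add.
Proof.
by move=> a; apply: padic_ext => n /=; rewrite /red modzDml addNr.
Qed.

HB.instance Definition _ :=
  GRing.isZmodule.Build Zl padic_addA padic_addC padic_add0 padic_addN.

Fact padic_mulA : associative padic_mul.
Proof.
by move=> a b c; apply: padic_ext => n /=; rewrite /red modzMmr modzMml mulrA.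
Qed.

Fact padic_mulC : commutative padic_mul.
Proof. by move=> a b; apply: padic_ext => n /=; rewrite mulrC. Qed.

Fact padic_mul1 : left_id (padic_const 1) padic_mul.
Proof.
move=> a; apply: padic_ext => n /=.
by rewrite /red modzMml mul1r; exact: res_red.
Qed.

Fact padic_mulDl : left_distributive padic_mul padic_add.
Proof.
move=> a b c; apply: padic_ext => n /=.
by rewrite /red modzMml modzDm mulrDl.
Qed.

Fact padic_1neq0 : padic_const 1 != padic_const 0.
Proof.
apply/eqP => /(congr1 (fun a : Zl => a 1%N)) /=.
by rewrite /red /q expn1 mod0z modz_small // ltz_nat prime_gt1.
Qed.

HB.instance Definition _ := GRing.Zmodule_isComNzRing.Build Zl
  padic_mulA padic_mulC padic_mul1 padic_mulDl padic_1neq0.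

Lemma padic_res0 n : (0 : Zl) n = 0.
Proof. by rewrite /= /red mod0z. Qed.

Definition padic_unit : pred Zl := fun a => `[< exists b, b * a = 1 >].

Definition padic_inv a : Zl :=
  if pselect (exists b, b * a = 1) is left ex then projT1 (cid ex) else a.

Fact padic_mulVx : {in padic_unit, left_inverse 1 padic_inv *%R}.
Proof.
move=> a /asboolP ex; rewrite /padic_inv.
by case: pselect => // ex'; exact: (projT2 (cid ex')).
Qed.

Fact padic_unitPl a b : b * a = 1 -> padic_unit a.
Proof. by move=> ba; apply/asboolP; exists b. Qed.

Fact padic_invr_out : {in [predC padic_unit], padic_inv =1 id}.
Proof.
move=> a /negP nu; rewrite /padic_inv.
by case: pselect => // ex; case: nu; apply/asboolP.
Qed.

HB.instance Definition _ := GRing.ComNzRing_hasMulInverse.Build Zl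
  padic_mulVx padic_unitPl padic_invr_out.

Lemma res_dvd a n m : ((l ^ n)%N %| a (n + m)%N)%Z = (a n == 0).
Proof.
have -> : a n = (a (n + m)%N %% (l ^ n)%N)%Z.
  elim: m => [|m IHm]; first by rewrite addn0 [in LHS]padicP [in RHS]padicP modz_mod.
  rewrite IHm addnS [a (n + m)%N]padicP; set x := a _.
  rewrite [in RHS](divz_eq x (l ^ (n + m))%N).
  have e : (l ^ (n + m))%N = (l ^ m)%N%:Z * (l ^ n)%N :> int by rewrite -PoszM mulnC expnD.
  by rewrite [X in _ * X + _]e mulrA modzMDl.
by apply/dvdz_mod0P/eqP.
Qed.

Fact padic_idomain a b : a * b = 0 -> (a == 0) || (b == 0).
Proof.
move=> ab0; apply: contraT; rewrite negb_or => /andP[a0 b0].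
have nz c : c != 0 -> exists n, c n != 0.
  move=> c0; apply: contrapT => nex; case/eqP: c0; apply: padic_ext => n.
  by rewrite padic_res0; apply/eqP; apply: contraT => cn; case: nex; exists n.
have [[n an] [m bm]] := (nz a a0, nz b b0).
have := congr1 (fun c : Zl => c (n + m)%N) ab0.
rewrite padic_res0 /= => /dvdz_mod0P.
move: an bm; rewrite -(res_dvd a n m) -(res_dvd b m n) [in b _]addnC.
rewrite !dvdzE abszM /= => an bm.
set x := absz _ in an *; set y := absz _ in bm *.
have x0 : (0 < x)%N by rewrite lt0n; apply: contra an => /eqP->.
have y0 : (0 < y)%N by rewrite lt0n; apply: contra bm => /eqP->.
rewrite pfactor_dvdn ?muln_gt0 ?x0 // lognM //.
move: an bm; rewrite !pfactor_dvdn // -!ltnNge => an bm dv.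
by have := leq_trans (leq_add an (ltnW bm)) dv; rewrite addSn ltnn.
Qed.

HB.instance Definition _ :=
  GRing.ComUnitRing_isIntegral.Build Zl padic_idomain.

(* The inverse limit topology: the sets of all b with b = a modulo l^n form a
   base of neighbourhoods of a. *)
Definition padic_nbhs a : set_system Zl :=
  [set A | exists n, forall b, b n = a n -> A b].

HB.instance Definition _ := hasNbhs.Build Zl padic_nbhs.

Lemma res_leq a b n m : (n <= m)%N -> b m = a m -> b n = a n.
Proof.
elim: m => [|m IHm]; first by rewrite leqn0 => /eqP->.
rewrite leq_eqVlt => /predU1P[-> //|nm ab]; apply: IHm => //.
by rewrite padicP ab -padicP.
Qed.

Fact padic_nbhs_filter a : ProperFilter (nbhs a).
Proof.
split; first by case=> n /(_ a erefl).
split; first by exists 0%N.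
- move=> A B [n An] [m Bm]; exists (maxn n m) => b ab; split.
    by apply: An; apply: res_leq ab; exact: leq_maxl.
  by apply: Bm; apply: res_leq ab; exact: leq_maxr.
- by move=> A B AB [n An]; exists n => b /An /AB.
Qed.

Fact padic_nbhs_singleton a (A : set Zl) : nbhs a A -> A a.
Proof. by case=> n; exact. Qed.

Fact padic_nbhs_nbhs a (A : set Zl) : nbhs a A -> nbhs a (nbhs^~ A).
Proof. by case=> n An; exists n => b ba; exists n => c cb; apply: An; rewrite cb. Qed.

HB.instance Definition _ := Nbhs_isNbhsTopological.Build Zl
  padic_nbhs_filter padic_nbhs_singleton padic_nbhs_nbhs.

End PadicInt.

Notation padic_num lP := {fraction padic_int lP}.

(* A (x)_R M for a morphism f : R -> A of commutative rings, as a module over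
   A: the free abelian group on A * M modulo the usual relations. *)
Section Tensor.
Variables (R A : comNzRingType) (f : {rmorphism R -> A}) (M : lmodType R).

Let FG := {freeg (A * M)%type}.

Definition tensor_rel : set FG := fun x =>
  [\/ exists a a' m, x = << (a + a', m) >> - << (a, m) >> - << (a', m) >>,
      exists a m m', x = << (a, m + m') >> - << (a, m) >> - << (a, m') >>
    | exists a r m, x = << (a * f r, m) >> - << (a, r *: m) >>].

Definition tensor_null : {pred FG} := fun x =>
  `[< forall S : {pred FG}, zmod_closed S ->
      (forall y, tensor_rel y -> y \in S) -> x \in S >].

Fact tensor_null_closed : zmod_closed tensor_null.
Proof.
split=> [|x y /asboolP Nx /asboolP Ny]; apply/asboolP => S zS rS.
  by case: zS.
by case: (zS) => _; apply; [exact: Nx | exact: Ny].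
Qed.

HB.instance Definition _ := GRing.isZmodClosed.Build FG tensor_null
  tensor_null_closed.

Definition tensor : Type := Quotient.quot tensor_null.

HB.instance Definition _ := GRing.Zmodule.on tensor.
HB.instance Definition _ :=
  EqQuotient.copy tensor (Quotient.quot tensor_null).

Definition pure_tensor (a : A) (m : M) : tensor := \pi_tensor << (a, m) >>.

Definition fg_scale (b : A) (x : FG) : FG :=
  fglift (fun am : A * M => << (b * am.1, am.2) >> : FG) x.

Definition tensor_scale (b : A) (x : tensor) : tensor :=
  \pi_tensor (fg_scale b (repr x)).

Fact fg_scale_is_additive b : zmod_morphism (fg_scale b).
Proof. exact: lift_is_additive. Qed.

HB.instance Definition _ b :=
  GRing.isZmodMorphism.Build FG FG (fg_scale b) (fg_scale_is_additive b).

Lemma fg_scaleU b a m : fg_scale b << (a, m) >> = << (b * a, m) >>.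
Proof. by rewrite /fg_scale liftU scale1r. Qed.

Lemma tensor_piE (x y : FG) :
  (\pi_tensor x = \pi_tensor y) <-> (x - y \in tensor_null).
Proof. by rewrite Quotient.idealrBE; split => [/eqP|/eqP]. Qed.

Lemma tensor_piD : {morph \pi_tensor : x y / x + y}.
Proof. exact: (raddfD (\pi_(Quotient.quot tensor_null))). Qed.

Lemma fg_ext (V : zmodType) (g h : {additive FG -> V}) :
  (forall a m, g << (a, m) >> = h << (a, m) >>) -> g =1 h.
Proof.
move=> gh x; rewrite -(freeg_sumE x) !raddf_sum; apply: eq_bigr => -[a m] _.
have -> : << coeff (a, m) x *g (a, m) >> = << (a, m) >> *~ coeff (a, m) x :> FG.
  by rewrite freeg_mulz intz.
by rewrite !raddfMz gh.
Qed.

Lemma fg_scale_null b x : x \in tensor_null -> fg_scale b x \in tensor_null.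
Proof.
move=> /asboolP Nx; apply/asboolP => S zS rS.
have [S0 SB] := zS.
apply: (Nx [pred y | fg_scale b y \in S]).
  split => [|y z]; rewrite !inE ?raddf0 // => ? ?.
  by rewrite raddfB; exact: SB.
move=> y [] [a [a' [m ->]]]; rewrite inE !raddfB /= !fg_scaleU; apply: rS.
- by apply: Or31; exists (b * a), (b * a'), m; rewrite mulrDr.
- by apply: Or32; exists (b * a), a', m.
- by apply: Or33; exists (b * a), a', m; rewrite mulrA.
Qed.

Lemma tensor_scale_pi b x :
  tensor_scale b (\pi_tensor x) = \pi_tensor (fg_scale b x).
Proof.
apply/tensor_piE; rewrite -raddfB; apply: fg_scale_null.
by apply/tensor_piE; rewrite reprK.
Qed.

Lemma tensor_scale_pure b a m :
  tensor_scale b (pure_tensor a m) = pure_tensor (b * a) m.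
Proof. by rewrite tensor_scale_pi fg_scaleU. Qed.

Fact tensor_scaleA b c x :
  tensor_scale b (tensor_scale c x) = tensor_scale (b * c) x.
Proof.
elim/quotW: x => x.
rewrite (tensor_scale_pi c) !tensor_scale_pi; congr (\pi_tensor _).
apply: (@fg_ext FG (fg_scale b \o fg_scale c) (fg_scale (b * c)) _ x) => a m.
by rewrite /= !fg_scaleU mulrA.
Qed.

Fact tensor_scale1 : left_id 1 tensor_scale.
Proof.
elim/quotW => x; rewrite tensor_scale_pi; congr (\pi_tensor _).
apply: (@fg_ext FG (fg_scale 1) idfun _ x) => a m.
by rewrite /= fg_scaleU mul1r.
Qed.

Fact tensor_scaleDr : right_distributive tensor_scale +%R.
Proof.
move=> b; elim/quotW => x; elim/quotW => y.
by rewrite -tensor_piD !tensor_scale_pi raddfD tensor_piD.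
Qed.

Fact tensor_scaleDl x : {morph tensor_scale^~ x : b c / b + c}.
Proof.
move=> b c; elim/quotW: x => x; rewrite !tensor_scale_pi -tensor_piD.
pose p : {additive FG -> Quotient.quot tensor_null} :=
  \pi_(Quotient.quot tensor_null).
apply: (@fg_ext (Quotient.quot tensor_null) (p \o fg_scale (b + c))
          (p \o (fg_scale b \+ fg_scale c)) _ x) => a m.
rewrite /= !fg_scaleU; apply/tensor_piE; apply/asboolP => S _; apply.
by apply: Or31; exists (b * a), (c * a), m; rewrite mulrDl opprD addrA.
Qed.

HB.instance Definition _ := GRing.Zmodule_isLmodule.Build A tensor
  tensor_scaleA tensor_scale1 tensor_scaleDr tensor_scaleDl.

End Tensor.

Section Completion.
Variable (A : zmodType).

Definition multiples (m : nat) : {pred A} := fun x => `[< exists y, x = y *+ m >].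

Fact multiples_closed m : zmod_closed (multiples m).
Proof.
split=> [|x y /asboolP[u ->] /asboolP[v ->]]; apply/asboolP.
  by exists 0; rewrite mul0rn.
by exists (u - v); rewrite mulrnBl.
Qed.

HB.instance Definition _ m := GRing.isZmodClosed.Build A (multiples m)
  (multiples_closed m).

End Completion.
Arguments multiples {A} m.

Section AdicCompletion.
Variables (l : nat) (A : zmodType).

Definition lquot (n : nat) : Type := Quotient.quot (@multiples A (l ^ n)).

HB.instance Definition _ n := GRing.Zmodule.on (lquot n).
HB.instance Definition _ n :=
  EqQuotient.copy (lquot n) (Quotient.quot (@multiples A (l ^ n))).

Definition lproj n (x : lquot n.+1) : lquot n := \pi_(lquot n) (repr x).

Lemma lquot_piE n (x y : A) :
  (\pi_(lquot n) x = \pi_(lquot n) y) <-> (x - y \in multiples (l ^ n)).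
Proof. by rewrite Quotient.idealrBE; split => [/eqP|/eqP]. Qed.

Fact lquot_pi_additive n : zmod_morphism (\pi_(lquot n) : A -> lquot n).
Proof. exact: (raddfB (\pi_(Quotient.quot (@multiples A (l ^ n))))). Qed.

HB.instance Definition _ n :=
  GRing.isZmodMorphism.Build A (lquot n) (\pi_(lquot n)) (@lquot_pi_additive n).

Lemma lproj_pi n (x : A) : lproj (\pi_(lquot n.+1) x) = \pi_(lquot n) x.
Proof.
have : \pi_(lquot n.+1) (repr (\pi_(lquot n.+1) x)) = \pi_(lquot n.+1) x.
  by rewrite reprK.
move=> /lquot_piE/asboolP[y e]; apply/lquot_piE/asboolP; exists (y *+ l).
by rewrite e expnS mulrnA.
Qed.

Fact lproj_additive n : zmod_morphism (@lproj n).
Proof.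
by elim/quotW => x; elim/quotW => y; rewrite -raddfB !lproj_pi raddfB.
Qed.

HB.instance Definition _ n :=
  GRing.isZmodMorphism.Build (lquot n.+1) (lquot n) (@lproj n)
    (@lproj_additive n).

(* The l-adic completion lim_n A / l^n A.  The primality proof is a parameter
   of the type because it is needed by its structure of Z_l-module. *)
Record completion (lP : prime l) := Completion {
  comp :> forall n, lquot n;
  compP : forall n, comp n = lproj (comp n.+1) }.

Variable lP : prime l.
Local Notation cpl := (completion lP).

HB.instance Definition _ := gen_eqMixin cpl.
HB.instance Definition _ := gen_choiceMixin cpl.

Implicit Types (x y z : cpl) (a b : padic_int lP).

Lemma comp_ext x y : (forall n, x n = y n) -> x = y.
Proof.
case: x y => [f fP] [g gP] /= fg.
have e : f = g by apply: functional_extensionality_dep.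
by subst g; congr Completion; exact: Prop_irrelevance.
Qed.

Fact comp_zeroP n : (0 : lquot n) = lproj (0 : lquot n.+1).
Proof. by rewrite raddf0. Qed.

Definition comp_zero := Completion lP comp_zeroP.

Fact comp_oppP x n : - x n = lproj (- x n.+1).
Proof. by rewrite raddfN /= -compP. Qed.

Definition comp_opp x := Completion lP (comp_oppP x).

Fact comp_addP x y n : x n + y n = lproj (x n.+1 + y n.+1).
Proof. by rewrite raddfD /= -!compP. Qed.

Definition comp_add x y := Completion lP (comp_addP x y).

Fact comp_addA : associative comp_add.
Proof. by move=> x y z; apply: comp_ext => n /=; rewrite addrA. Qed.

Fact comp_addC : commutative comp_add.
Proof. by move=> x y; apply: comp_ext => n /=; rewrite addrC. Qed.

Fact comp_add0 : left_id comp_zero comp_add.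
Proof. by move=> x; apply: comp_ext => n /=; rewrite add0r. Qed.

Fact comp_addN : left_inverse comp_zero comp_opp comp_add.
Proof. by move=> x; apply: comp_ext => n /=; rewrite addNr. Qed.

HB.instance Definition _ :=
  GRing.isZmodule.Build cpl comp_addA comp_addC comp_add0 comp_addN.

Lemma lquot_modz n (u : lquot n) (k : int) : u *~ (k %% (l ^ n)%N)%Z = u *~ k.
Proof.
elim/quotW: u => u; rewrite [in RHS](divz_eq k (l ^ n)%N) [RHS]mulrzDr.
rewrite [X in _ = X + _](_ : _ = 0) ?add0r // -raddfMz -[RHS](raddf0 (\pi_(lquot n))).
apply/lquot_piE/asboolP; exists (u *~ (k %/ (l ^ n)%N)%Z).
by rewrite subr0 mulrzA -pmulrn.
Qed.

Fact comp_scaleP a x n : x n *~ a n = lproj (x n.+1 *~ a n.+1).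
Proof. by rewrite raddfMz /= -compP padicP lquot_modz. Qed.

Definition comp_scale a x := Completion lP (comp_scaleP a x).

Fact comp_scaleA a b x : comp_scale a (comp_scale b x) = comp_scale (a * b) x.
Proof. by apply: comp_ext => n /=; rewrite lquot_modz -mulrzA mulrC. Qed.

Fact comp_scale1 : left_id 1 comp_scale.
Proof. by move=> x; apply: comp_ext => n /=; rewrite lquot_modz. Qed.

Fact comp_scaleDr : right_distributive comp_scale +%R.
Proof. by move=> a x y; apply: comp_ext => n /=; rewrite mulrzDl. Qed.

Fact comp_scaleDl x : {morph comp_scale^~ x : a b / a + b}.
Proof. by move=> a b; apply: comp_ext => n /=; rewrite lquot_modz mulrzDr. Qed.

End AdicCompletion.
Arguments completion {l} A lP.

HB.instance Definition _ (l : nat) (lP : prime l) (A : zmodType) :=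
  GRing.Zmodule_isLmodule.Build (padic_int lP) (completion A lP)
    (@comp_scaleA l A lP) (@comp_scale1 l A lP) (@comp_scaleDr l A lP)
    (@comp_scaleDl l A lP).

(* F^* written additively: 0, x + y, x *+ n stand for 1, x * y, x ^+ n. *)
Section MulGroup.
Variable F : fieldType.

Definition mulgroup : Type := {x : F | x != 0}.

HB.instance Definition _ := SubChoice.on mulgroup.

Implicit Types x y : mulgroup.

Definition mg_one : mulgroup := exist _ 1 (oner_neq0 F).

Fact mg_inv_neq0 x : (val x)^-1 != 0.
Proof. by rewrite invr_eq0 (valP x). Qed.

Definition mg_inv x : mulgroup := exist _ (val x)^-1 (mg_inv_neq0 x).

Fact mg_mul_neq0 x y : val x * val y != 0.
Proof. by rewrite mulf_neq0 ?(valP x) ?(valP y). Qed.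

Definition mg_mul x y : mulgroup := exist _ (val x * val y) (mg_mul_neq0 x y).

Fact mg_mulA : associative mg_mul.
Proof. by move=> x y z; apply: val_inj; rewrite /= mulrA. Qed.

Fact mg_mulC : commutative mg_mul.
Proof. by move=> x y; apply: val_inj; rewrite /= mulrC. Qed.

Fact mg_mul1 : left_id mg_one mg_mul.
Proof. by move=> x; apply: val_inj; rewrite /= mul1r. Qed.

Fact mg_mulV : left_inverse mg_one mg_inv mg_mul.
Proof. by move=> x; apply: val_inj; rewrite /= mulVf ?(valP x). Qed.

HB.instance Definition _ :=
  GRing.isZmodule.Build mulgroup mg_mulA mg_mulC mg_mul1 mg_mulV.

End MulGroup.

Section Galois.
Variables (F L : fieldType) (iota : {rmorphism F -> L}).

(* The minimal polynomial of x over F is, up to a scalar, the irreducible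
   polynomial that vanishes at x. *)
Definition separable_elt (x : L) : Prop :=
  exists p : {poly F}, [/\ irreducible_poly p, separable_poly p
                         & root (map_poly iota p) x].

Definition separable_closure : Prop :=
  (forall x : L, separable_elt x) /\
  (forall p : {poly L}, separable_poly p -> size p != 1%N -> exists x, root p x).

Record subextension := SubExtension {
  subext :> {pred L};
  subext_divring : divring_closed subext;
  subext_base : forall x, iota x \in subext }.

HB.instance Definition _ (K : subextension) :=
  GRing.isDivringClosed.Build L (subext K) (subext_divring K).

Definition subfield (K : subextension) : Type := {x : L | x \in subext K}.

HB.instance Definition _ K := SubChoice.on (subfield K).
HB.instance Definition _ K :=
  [SubChoice_isSubIntegralDomain of subfield K by <:].
HB.instance Definition _ K :=
  [SubIntegralDomain_isSubField of subfield K by <:].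

Definition in_subfield (K : subextension) (x : F) : subfield K :=
  exist _ (iota x) (subext_base K x).

Definition galois_ext (K : subextension) : Prop :=
  (forall x, x \in K -> separable_elt x) /\
  (forall p : {poly F}, irreducible_poly p ->
     (exists2 x, x \in K & root (map_poly iota p) x) ->
     exists2 s : seq L, {subset s <= K} &
       map_poly iota p %= \prod_(z <- s) ('X - z%:P)).

Section Gal.
Variable K : subextension.

Record gal := Gal {
  gal_fun :> subfield K -> subfield K;
  galD : {morph gal_fun : x y / x + y};
  galM : {morph gal_fun : x y / x * y};
  gal_base : forall x, gal_fun (in_subfield K x) = in_subfield K x;
  gal_bij : bijective gal_fun }.

HB.instance Definition _ := gen_eqMixin gal.
HB.instance Definition _ := gen_choiceMixin gal.

Implicit Types s t u : gal.

Lemma gal_ext s t : s =1 t -> s = t.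
Proof.
case: s t => [f fD fM fF fb] [g gD gM gF gb] /= /funext e; subst g.
by congr Gal; exact: Prop_irrelevance.
Qed.

Definition gal_one : gal.
Proof. by exists id => //; exists id. Defined.

Definition gal_mul s t : gal.
Proof.
exists (s \o t) => [x y|x y|x|]; rewrite /= ?galD ?galM ?gal_base //.
by apply: bij_comp; exact: gal_bij.
Defined.

Lemma gal_inv_ex s : exists g, cancel s g /\ cancel g s.
Proof. by case: (gal_bij s) => g sg gs; exists g. Qed.

Definition gal_inv_fun s := projT1 (cid (gal_inv_ex s)).

Lemma gal_invK s : cancel s (gal_inv_fun s).
Proof. exact: (projT2 (cid (gal_inv_ex s))).1. Qed.

Lemma gal_invKV s : cancel (gal_inv_fun s) s.
Proof. exact: (projT2 (cid (gal_inv_ex s))).2. Qed.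

Definition gal_inv s : gal.
Proof.
exists (gal_inv_fun s) => [x y|x y|x|].
- by apply: (can_inj (gal_invK s)); rewrite galD !gal_invKV.
- by apply: (can_inj (gal_invK s)); rewrite galM !gal_invKV.
- by apply: (can_inj (gal_invK s)); rewrite gal_base gal_invKV.
- by exists s; [exact: gal_invKV | exact: gal_invK].
Defined.

Fact gal_mulA : associative gal_mul.
Proof. by move=> s t u; apply: gal_ext. Qed.

Fact gal_mul1 : left_id gal_one gal_mul.
Proof. by move=> s; apply: gal_ext. Qed.

Fact gal_mulr1 : right_id gal_one gal_mul.
Proof. by move=> s; apply: gal_ext. Qed.

Fact gal_mulV : left_inverse gal_one gal_inv gal_mul.
Proof. by move=> s; apply: gal_ext => x /=; exact: gal_invK. Qed.

Fact gal_mulrV : right_inverse gal_one gal_inv gal_mul.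
Proof. by move=> s; apply: gal_ext => x /=; exact: gal_invKV. Qed.

HB.instance Definition _ :=
  isGroup.Build gal gal_mulA gal_mul1 gal_mulr1 gal_mulV gal_mulrV.

(* The Krull topology.  A base of neighbourhoods of s is given by the cosets
   s Gal(K/E) with E/F finite; for E = F(e_1, ..., e_n) such a coset is the set
   of the automorphisms that agree with s at e_1, ..., e_n, and K/F being
   algebraic, every finite sequence of elements of K generates such an E. *)
Definition krull_nbhs s : set_system gal :=
  [set A | exists e : seq (subfield K), forall t, {in e, t =1 s} -> A t].

HB.instance Definition _ := hasNbhs.Build gal krull_nbhs.

Fact krull_nbhs_filter s : ProperFilter (nbhs s).
Proof.
split; first by case=> e /(_ s); apply.
split; first by exists [::].
- move=> A B [e eA] [d dB]; exists (e ++ d) => t ts.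
  by split; [apply: eA | apply: dB] => x xin; apply: ts;
    rewrite mem_cat xin ?orbT.
- by move=> A B AB [e eA]; exists e => t /eA /AB.
Qed.

Fact krull_nbhs_singleton s (A : set gal) : nbhs s A -> A s.
Proof. by case=> e; apply. Qed.

Fact krull_nbhs_nbhs s (A : set gal) : nbhs s A -> nbhs s (nbhs^~ A).
Proof.
case=> e eA; exists e => t ts; exists e => u ut; apply: eA => x xe.
by rewrite ut ?ts.
Qed.

HB.instance Definition _ := Nbhs_isNbhsTopological.Build gal
  krull_nbhs_filter krull_nbhs_singleton krull_nbhs_nbhs.

End Gal.

Definition gal_iso_Zld (l : nat) (lP : prime l) (d : nat) (K : subextension) :
    Prop :=
  exists (phi : gal K -> 'rV[padic_int lP]_d)
         (psi : 'rV[padic_int lP]_d -> gal K),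
    [/\ {morph phi : s t / (s * t)%g >-> s + t}, cancel phi psi,
        cancel psi phi, continuous phi & continuous psi].

Definition Zld_extension (l : nat) (lP : prime l) (d : nat) :
    set subextension :=
  [set K | galois_ext K /\ gal_iso_Zld lP d K].

Definition mu_linfty (l : nat) : set L := [set z | exists n, z ^+ (l ^ n) = 1].

End Galois.
Arguments mu_linfty : clear implicits.
Arguments Zld_extension {F L} iota {l} lP d.

Definition Grass (k : fieldType) (d : nat) (V : lmodType k) : set (set V) :=
  [set W : set V | submod_closed (mem W) /\
     exists b : 'I_d -> V,
       (forall c : 'I_d -> k, \sum_i c i *: b i = 0 -> forall i, c i = 0) /\
       W = [set \sum_i c i *: b i | c in [set: 'I_d -> k]] ].
Arguments Grass {k} d V.

(* Q_l (x)_{Z_l} \hat{F^*}, where \hat{F^*} = lim_n F^* / (F^* )^(l^n) *)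
Definition Vhat (l : nat) (lP : prime l) (F : fieldType) :
    lmodType (padic_num lP) :=
  tensor (@FracField.tofrac (padic_int lP)) (completion (mulgroup F) lP).

(* Main.v *)
Require Import Defs.
From HB Require Import structures.
From mathcomp Require Import all_boot all_order all_algebra.
From mathcomp Require Import separable generic_quotient freeg.
From mathcomp Require Import boolp classical_sets functions topology.

Set Implicit Arguments.
Unset Strict Implicit.
Unset Printing Implicit Defensive.

Import Order.TTheory GRing.Theory Num.Theory.
Local Open Scope classical_set_scope.
Local Open Scope ring_scope.

(** Write z_n for a compatible system of primitive l^n-th roots of unity of F
    and H for the l-adic completion of F^*, which is torsion-free because the
    l-power roots of unity of F form a divisible group.  To a subextension K of
    F^sep attach the saturated Z_l-submodule M_K of those x = (x_n) in H for
    which K contains, for every n, an l^n-th root of a representative of x_n.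
    By Hilbert 90, when Gal(K/F) is isomorphic to Z_l^d every coordinate of the
    isomorphism is the Kummer character of an element of M_K, and these
    elements form a Z_l-basis of M_K; so K is sent to the d-dimensional space
    spanned by M_K.  Conversely, a d-dimensional W meets H in a saturated
    lattice M with a Z_l-basis of d elements, and adjoining all the l^n-th roots
    of the components of elements of M gives an extension K whose Galois group
    is the dual of M, because radicals in distinct classes modulo F^* are
    linearly independent over F.  Then W is contained in the space attached
    to K, which has the same dimension. *)

(** * Extension of partial isomorphisms *)

(** Since the l-power roots of unity lie in F, an l^n-th root of a class modulo l^n-th powers is
    determined up to F^* alone. So one root at each level suffices, no compatible tower of roots is
    chosen, and s(b)/b depends only on the class; its exponents with respect to the z_n form a
    single l-adic integer. The group of K being infinite in general, finite levels are finite lists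
    of elements, as in the definition of the Krull topology. Continuity of the inverse isomorphism
    makes the group act on such a list through a finite quotient, so that the resolvent of Hilbert
    90 is a finite sum; continuity of the isomorphism itself makes its coordinates modulo l^n factor
    through such a quotient. Automorphisms come from two sources: for a given normal extension, from
    Zorn's lemma applied to graphs in L * L; for the extension built from a lattice, by prescribing
    them on radicals and extending to sums, which linear independence makes well defined. *)

Lemma monic_div_polyOver (R : comNzRingType) (S : subringClosed R)
    (P q : {poly R}) :
  P \is monic -> P \is a polyOver S -> q \is a polyOver S ->
  exists Q r, [/\ Q \is a polyOver S, r \is a polyOver S, q = Q * P + r
               & (size r < size P)%N].
Proof.
move=> mP SP; have [n le_q_n] := ubnP (size q).
elim: n q le_q_n => // n IHn q le_q_n Sq.
have [lt_qP|le_Pq] := ltnP (size q) (size P).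
  by exists 0, q; rewrite mul0r add0r polyOver0.
pose m := (size q - size P)%N; pose T : {poly R} := lead_coef q *: 'X^m.
have ST : T \is a polyOver S.
  by rewrite polyOverZ ?polyOverXn // /lead_coef; move/polyOverP: Sq; exact.
have sP : (0 < size P)%N by rewrite size_poly_gt0 monic_neq0.
have lt_q' : (size (q - T * P)%R <= (size q).-1)%N.
  case es : (size q) le_Pq => [|s] le_Pq; first by rewrite leqNgt sP in le_Pq.
  apply/leq_sizeP => j /= le_sj; rewrite coefB -scalerAl coefZ coefXnM.
  have le_ms : (m <= s)%N by rewrite /m es -(prednK sP) subSS leq_subr.
  rewrite ltnNge (leq_trans le_ms le_sj) /=.
  have [->|ne] := eqVneq j s.
    have -> : (s - m)%N = (size P).-1.
      by rewrite /m es -(prednK sP) subSS subKn // -ltnS prednK.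
    by move/monicP: mP; rewrite /lead_coef => ->; rewrite mulr1 es /= subrr.
  have lt_sj : (s < j)%N by rewrite ltn_neqAle eq_sym ne.
  rewrite !nth_default ?mulr0 ?subr0 ?es //.
  by rewrite leq_subRL /m es ?subnK // (leq_trans _ lt_sj) ?leq_subr.
have /IHn : (size (q - T * P)%R < n)%N.
  apply: leq_ltn_trans lt_q' _; rewrite prednK ?(leq_trans sP) //.
case=> [|Q [r [SQ Sr e ltr]]]; first by rewrite rpredB ?rpredM.
exists (T + Q), r; split=> //; first by rewrite rpredD.
by rewrite mulrDl -addrA -e addrC subrK.
Qed.

Lemma dvdp_prod_root (L : fieldType) (p : {poly L}) (rs : seq L) :
  p %| \prod_(z <- rs) ('X - z%:P) -> size p != 1%N -> exists z, root p z.
Proof.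
move=> /dvdp_prod_XsubC[m eq_p]; rewrite (eqp_size eq_p).
case: (mask m rs) eq_p => [|z s] eq_p; first by rewrite big_nil size_poly1.
by exists z; rewrite (eqp_root eq_p) root_prod_XsubC in_cons eqxx.
Qed.

Section PartialIsomorphisms.
Variables (F L : fieldType) (iota : {rmorphism F -> L}).

(** Once the power of ['X] is removed from [p], the constant term [c] is nonzero, and
    [q = r * 'X + c] gives [x * r(x) = - c]. Hence a ring of algebraic elements that contains F is a
    field; this supplies the inverses in graphs and in the Kummer extension. *)
Lemma inv_eq_horner (x : L) (p : {poly F}) :
  p != 0 -> root (map_poly iota p) x -> x != 0 ->
  exists q : {poly F}, x * (map_poly iota q).[x] = 1.
Proof.
move=> p0 px x0; have [m [q]] := multiplicity_XsubC p 0.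
rewrite p0 /= => q0 ep; move: px.
rewrite ep subr0 rmorphM rmorphXn /= map_polyX rootE hornerM hornerXn.
rewrite mulf_eq0 expf_eq0 (negPf x0) andbF orbF => /eqP qx.
have /factor_theorem[r] : root (q - (q.[0])%:P) 0.
  by rewrite rootE !hornerE subrr.
rewrite subr0 => /eqP; rewrite subr_eq => /eqP eq.
move: q0; rewrite rootE; move: q.[0] eq => c eq c0.
exists (- c^-1 *: r); move: qx.
rewrite eq rmorphD rmorphM /= map_polyX map_polyC !hornerE /= => /eqP.
rewrite addr_eq0 => /eqP e.
rewrite linearZ /= hornerZ mulrCA [x * _]mulrC e rmorphN mulrNN fmorphV mulVf //.
by rewrite fmorph_eq0.
Qed.

(* A partial isomorphism over F, given by its graph, as a subring of L * L. *)
Definition partial_iso (G : set (L * L)) :=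
  [/\ forall a, G (iota a, iota a), forall u v, G u -> G v -> G (u - v),
      forall u v, G u -> G v -> G (u * v) & forall y, G (0, y) -> y = 0].

Definition splits_at (x : L) := exists2 p : {poly F}, p != 0 &
  root (map_poly iota p) x /\
  exists rs : seq L, map_poly iota p %= \prod_(z <- rs) ('X - z%:P).

Definition diag_pair (a : F) : (L * L)%type := (iota a, iota a).

Fact diag_pair_is_zmod_morphism : zmod_morphism diag_pair.
Proof. by move=> a b; rewrite /diag_pair rmorphB. Qed.

Fact diag_pair_is_monoid_morphism : monoid_morphism diag_pair.
Proof. by split=> [|a b]; rewrite /diag_pair ?rmorph1 ?rmorphM. Qed.

HB.instance Definition _ := GRing.isZmodMorphism.Build F (L * L)%type diag_pair
  diag_pair_is_zmod_morphism.
HB.instance Definition _ := GRing.isMonoidMorphism.Build F (L * L)%type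
  diag_pair diag_pair_is_monoid_morphism.

Let diagM : {rmorphism F -> (L * L)%type} := diag_pair.

Definition graph_pred (G : set (L * L)) : {pred (L * L)%type} :=
  fun u => `[< G u >].

Let G_closed G : partial_iso G -> subring_closed (graph_pred G).
Proof.
move=> [G1 GB GM _]; split=> [|u v|u v]; rewrite !unfold_in.
- by apply/asboolP; move: (G1 1); rewrite rmorph1.
- by move=> /asboolP Gu /asboolP Gv; apply/asboolP; exact: GB.
- by move=> /asboolP Gu /asboolP Gv; apply/asboolP; exact: GM.
Qed.

(** A graph is a subring [S] of [L * L] on which the first projection is injective, and a field
    because its elements are algebraic. Let [P] over [S] be of least degree such that its first
    projection vanishes at [x]; then [y] is a root of its second projection, which splits since [P]
    divides the polynomial [p] of [x] over F. The new graph is S[(x, y)]. Division takes place in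
    [L * L], which has zero divisors, hence the need for a monic [P]. *)
Lemma partial_iso_extend (G : set (L * L)) (x : L) :
  (forall x, splits_at x) -> partial_iso G ->
  exists (G' : set (L * L)) (y : L), [/\ partial_iso G', G `<=` G' & G' (x, y)].
Proof.
move=> spl Giso; have [G1 GB GM G0] := Giso.
have [S SE] : exists S : subringClosed (L * L)%type,
    forall u, (u \in S) = `[< G u >].
  by exists (HB.pack_for (subringClosed (L * L)%type) (graph_pred G)
    (GRing.isSubringClosed.Build (L * L)%type (graph_pred G) (G_closed Giso))).
have Sdiag q : map_poly diagM q \is a polyOver S.
  by apply/polyOverP => i; rewrite coef_map SE; apply/asboolP/G1.
have Gfst u : u \in S -> u.1 = 0 -> u = 0.
  by case: u => u1 u2 /= + e; rewrite SE e => /asboolP/G0 ->.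
have Ginv u : u \in S -> u != 0 -> exists2 v, v \in S & v * u = 1.
  move=> Su u0; have [p p0 [pu _]] := spl u.1.
  have [|q qE] := inv_eq_horner p0 pu.
    by apply: contra u0 => /eqP/(Gfst _ Su)/eqP.
  exists (map_poly diagM q).[u]; first exact: rpred_horner.
  apply/eqP; rewrite -subr_eq0; apply/eqP/Gfst.
    by rewrite rpredB ?rpredM ?rpred1 ?rpred_horner.
  have -> : (map_poly diagM q).[u] =
      ((map_poly iota q).[u.1], (map_poly iota q).[u.2]).
    by rewrite [LHS]surjective_pairing -!horner_map -!map_poly_comp.
  by rewrite /= mulrC qE subrr.
pose f1 : {rmorphism (L * L)%type -> L} := @fst L L.
pose f2 : {rmorphism (L * L)%type -> L} := @snd L L.
pose ann n := `[< exists P, [/\ P \is a polyOver S, P != 0,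
  root (map_poly f1 P) x & size P = n] >].
have [p p0 [px [rs prs]]] := spl x.
have dpE : map_poly f1 (map_poly diagM p) = map_poly iota p.
  by rewrite -map_poly_comp.
have dp2E : map_poly f2 (map_poly diagM p) = map_poly iota p.
  by rewrite -map_poly_comp.
have ex_ann : exists n, ann n.
  exists (size (map_poly diagM p)); apply/asboolP; exists (map_poly diagM p).
  by rewrite dpE; split=> //; rewrite map_poly_eq0.
case: (ex_minnP ex_ann) => n /asboolP[P [SP P0 Px szP]] minP.
have small r : r \is a polyOver S -> root (map_poly f1 r) x ->
    (size r < n)%N -> r = 0.
  move=> Sr rx; rewrite ltnNge; apply: contraNeq => r0; apply: minP.
  by apply/asboolP; exists r.
wlog mP : P SP P0 Px szP / P \is monic.
  move=> H; have [||w Sw wP] := @Ginv (lead_coef P).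
    by move/polyOverP: SP; exact.
    by rewrite lead_coef_eq0.
  have szw : size (w *: P) = size P.
    apply: lreg_size => a b /(congr1 ( *%R^~ (lead_coef P))).
    by rewrite mulrAC wP mul1r mulrAC wP mul1r.
  apply: (H (w *: P)).
  - exact: polyOverZ.
  - by rewrite -size_poly_gt0 szw size_poly_gt0.
  - by rewrite rootE map_polyZ hornerZ (eqP Px) mulr0.
  - by rewrite szw.
  - by apply/monicP; rewrite /lead_coef szw coefZ.
have div q : q \is a polyOver S -> root (map_poly f1 q) x ->
    exists Q, q = Q * P.
  move=> Sq qx; have [Q [r [SQ Sr eq lt_r]]] := monic_div_polyOver mP SP Sq.
  exists Q; rewrite eq (small r) ?addr0 -?szP //; move: qx.
  by rewrite eq rmorphD rmorphM /= !rootE !hornerE (eqP Px) mulr0 add0r.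
have [y Py] : exists y, root (map_poly f2 P) y.
  apply: (@dvdp_prod_root _ _ rs).
    rewrite -(eqp_dvdr _ prs) -dp2E.
    have [|Q ->] := div (map_poly diagM p) (Sdiag p); first by rewrite dpE.
    by rewrite rmorphM /= dvdp_mull.
  have sz2 : size (map_poly f2 P) = size (map_poly f1 P).
    by rewrite !size_map_poly_id0 // (monicP mP) oner_eq0.
  rewrite sz2; apply: contraTN Px => /size_poly1P[c c0 ->].
  by rewrite rootC.
have hE q : q.[(x, y)] = ((map_poly f1 q).[x], (map_poly f2 q).[y]).
  by rewrite [LHS]surjective_pairing -!horner_map.
exists [set u | exists2 q, q \is a polyOver S & u = q.[(x, y)]], y; split.
- split.
  + move=> a; exists (map_poly diagM a%:P); first exact: Sdiag.
    by rewrite map_polyC hornerC.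
  + by move=> _ _ [q Sq ->] [r Sr ->]; exists (q - r);
      rewrite ?rpredB ?hornerE.
  + by move=> _ _ [q Sq ->] [r Sr ->]; exists (q * r);
      rewrite ?rpredM ?hornerE.
  + move=> z [q Sq]; rewrite hE => -[qx ->].
    have [|Q ->] := div q Sq; first by rewrite rootE -qx.
    by rewrite rmorphM /= hornerM (eqP Py) mulr0.
- move=> u Gu; exists u%:P; last by rewrite hornerC.
  by rewrite polyOverC SE; apply/asboolP.
- by exists 'X; rewrite ?polyOverX ?hornerX.
Qed.

End PartialIsomorphisms.

(** * Automorphisms of a normal extension *)

Section Automorphisms.
Variables (F L : fieldType) (iota : {rmorphism F -> L}).

Definition field_aut (s : L -> L) :=
  [/\ {morph s : x y / x + y}, {morph s : x y / x * y},
      forall a, s (iota a) = iota a & bijective s].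

Lemma morph_base_rmorphism (s : L -> L) :
  {morph s : x y / x + y} -> {morph s : x y / x * y} ->
  (forall a, s (iota a) = iota a) -> exists t : {rmorphism L -> L}, s =1 t.
Proof.
move=> sD sM s1.
have s0 : s 0 = 0 by rewrite -(rmorph0 iota) s1.
have sB : zmod_morphism s.
  move=> x y; apply: (addIr (s y)); rewrite -sD !subrK //.
have sm : monoid_morphism s by split=> //; rewrite -(rmorph1 iota) s1.
by exists (HB.pack_for {rmorphism L -> L} s
  (GRing.isZmodMorphism.Build L L s sB) (GRing.isMonoidMorphism.Build L L s sm)).
Qed.

Lemma field_aut_rmorphism s : field_aut s ->
  exists t : {rmorphism L -> L}, s =1 t.
Proof. by case=> sD sM s1 _; exact: morph_base_rmorphism. Qed.

Lemma morph_root (s : {rmorphism L -> L}) (p : {poly F}) z :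
  (forall a, s (iota a) = iota a) ->
  root (map_poly iota p) z -> root (map_poly iota p) (s z).
Proof.
move=> s1 /eqP pz; apply/eqP.
have -> : map_poly iota p = map_poly s (map_poly iota p).
  by rewrite -map_poly_comp; apply: eq_map_poly => a /=; rewrite s1.
by rewrite horner_map pz rmorph0.
Qed.

(** A maximal partial isomorphism is total, since it could otherwise be extended to a further
    element. It is onto because it maps the finite set of roots of a split polynomial over F
    injectively into itself. *)
Lemma partial_iso_field_aut (G0 : set (L * L)) :
  (forall x, splits_at iota x) -> partial_iso iota G0 ->
  exists2 s, field_aut s & forall u, G0 u -> s u.1 = u.2.
Proof.
move=> spl G0iso.
have ne G : partial_iso iota G -> G != set0.
  by case=> /(_ 0) G0' _ _ _; apply/set0P; exists (iota 0, iota 0).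
pose P (A : set (L * L)) := A = set0 \/ partial_iso iota A /\ G0 `<=` A.
have [|A [PA maxA]] := @Zorn_bigcup _ P.
  move=> C PC totC.
  have [[A0 CA0 A00]|allE] := pselect (exists2 A, C A & A !=set0); last first.
    left; apply/seteqP; split=> // u [A CA Au].
    by case: allE; exists A => //; exists u.
  have C2 u v : (\bigcup_(X in C) X) u -> (\bigcup_(X in C) X) v ->
      exists X, [/\ C X, partial_iso iota X, X u & X v].
    have use X w : C X -> X w -> partial_iso iota X.
      by move=> CX Xw; case: (PC _ CX) => [E|[]//]; rewrite E in Xw.
    move=> [X CX Xu] [Y CY Yv]; case: (totC _ _ CX CY) => XY.
      by exists Y; split=> //; [exact: use Yv|exact: XY].
    by exists X; split=> //; [exact: use Xu|exact: XY].
  have [A0iso GA0] : partial_iso iota A0 /\ G0 `<=` A0.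
    by case: (PC _ CA0) => // E; case: A00 => u; rewrite E.
  right; split; last by move=> u /GA0 A0u; exists A0.
  split.
  - by move=> a; exists A0 => //; case: A0iso.
  - move=> u v Cu Cv; have [X [CX [_ XB _ _] Xu Xv]] := C2 u v Cu Cv.
    by exists X => //; exact: XB.
  - move=> u v Cu Cv; have [X [CX [_ _ XM _] Xu Xv]] := C2 u v Cu Cv.
    by exists X => //; exact: XM.
  - move=> y Cy; have [X [CX [_ _ _ X0] Xy _]] := C2 _ _ Cy Cy.
    exact: X0.
have {PA} [Aiso GA] : partial_iso iota A /\ G0 `<=` A.
  case: PA => // A0; case: (maxA G0); last by right; split.
  split; first by rewrite A0.
  by move=> G0A; move/set0P: (ne _ G0iso) => [u /G0A]; rewrite A0.
have [A1 AB AM A0] := Aiso.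
have tot x : exists y, A (x, y).
  have [G' [y [G'iso AG' G'xy]]] := partial_iso_extend x spl Aiso.
  exists y; apply: contrapT => nA; case: (maxA G'); last first.
    by right; split=> // u /GA /AG'.
  by split=> // G'A; case: nA; apply: G'A.
have func x y y' : A (x, y) -> A (x, y') -> y = y'.
  move=> Ay Ay'; apply/eqP; rewrite -subr_eq0; apply/eqP/A0.
  by rewrite -(subrr x); exact: (AB _ _ Ay Ay').
pose s x := projT1 (cid (tot x)).
have As x : A (x, s x) := projT2 (cid (tot x)).
have s1 a : s (iota a) = iota a by apply: func (As _) (A1 a).
have sB x y : s (x - y) = s x - s y by apply: func (As _) (AB _ _ (As x) (As y)).
have sM x y : s (x * y) = s x * s y by apply: func (As _) (AM _ _ (As x) (As y)).
have s0 : s 0 = 0 by rewrite -(rmorph0 iota) s1.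
have sD x y : s (x + y) = s x + s y.
  have sN z : s (- z) = - s z by rewrite -sub0r sB s0 sub0r.
  by rewrite -{1}(opprK y) sB sN opprK.
have [t st] := morph_base_rmorphism sD sM s1.
have s_inj : injective s by move=> x y; rewrite !st; exact: fmorph_inj.
have s_surj y : exists x, s x = y.
  have [p p0 [py [rs prs]]] := spl y.
  have rsE z : (z \in undup rs) = root (map_poly iota p) z.
    by rewrite mem_undup (eqp_root prs) root_prod_XsubC.
  have um : uniq (map s (undup rs)) by rewrite map_inj_uniq ?undup_uniq.
  have sub : {subset map s (undup rs) <= undup rs}.
    move=> _ /mapP[z zrs ->]; rewrite rsE st morph_root -?rsE // => a.
    by rewrite -st.
  have [|_ /(_ y)] := uniq_min_size um sub; first by rewrite size_map.
  by rewrite rsE py => /mapP[x _ ->]; exists x.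
exists s; last by move=> [x y] /GA; exact: func.
split=> //; exists (fun y => projT1 (cid (s_surj y))) => [x|y].
  exact: s_inj (projT2 (cid (s_surj (s x)))).
exact: projT2 (cid (s_surj y)).
Qed.

Lemma irreducible_dvd_annihilator (r p : {poly F}) x :
  irreducible_poly r -> root (map_poly iota r) x -> root (map_poly iota p) x ->
  r %| p.
Proof.
move=> irr_r rx px.
have [/eqp_size sz|] := irredp_XsubCP irr_r (dvdp_gcdl r p).
  have : coprimep (map_poly iota r) (map_poly iota p).
    by rewrite coprimep_map /coprimep sz size_poly1.
  by move=> /coprimep_root/(_ rx); rewrite (eqP px) eqxx.
by move=> /eqp_dvdl <-; exact: dvdp_gcdr.
Qed.

Lemma irreducible_annihilator x (p : {poly F}) :
  p != 0 -> root (map_poly iota p) x ->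
  exists2 r : {poly F}, irreducible_poly r & root (map_poly iota r) x.
Proof.
move=> p0 px.
pose ann n := `[< exists q : {poly F},
  [/\ q != 0, root (map_poly iota q) x & size q = n] >].
have ex : exists n, ann n by exists (size p); apply/asboolP; exists p.
case: (ex_minnP ex) => n /asboolP[r [r0 rx szr]] minr; exists r => //.
split=> [|q szq dvq].
  rewrite ltn_neqAle size_poly_gt0 r0 andbT; apply: contraTN rx.
  by rewrite eq_sym => /size_poly1P[c c0 ->]; rewrite map_polyC rootC fmorph_eq0.
have [t et] : exists t, r = t * q by move/dvdpP: dvq.
move: r0 rx; rewrite et mulf_eq0 negb_or rmorphM rootM => /andP[t0 q0].
have le q' : q' != 0 -> root (map_poly iota q') x -> (size r <= size q')%N.
  by move=> q'0 q'x; rewrite szr minr //; apply/asboolP; exists q'.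
move=> /orP[/(le _ t0)|/(le _ q0) sz].
  rewrite et size_mul // => lett; case/eqP: szq; apply/eqP.
  rewrite eqn_leq size_poly_gt0 q0 andbT.
  move: lett; case: (size q) => [|[|k]] //; rewrite addnS /= addnS.
  by rewrite ltnNge leq_addr.
rewrite -et -(dvdp_size_eqp dvq) eqn_leq sz andbT.
by apply: dvdp_leq => //; rewrite et mulf_neq0.
Qed.

(** The graph to extend is that of F(x) -> F(y), made of the pairs (q(x), q(y)); it is single-valued
    because [p] divides every [q] that vanishes at [x]. *)
Lemma field_aut_transitive (p : {poly F}) x y :
  (forall x, splits_at iota x) -> irreducible_poly p ->
  root (map_poly iota p) x -> root (map_poly iota p) y ->
  exists2 s, field_aut s & s x = y.
Proof.
move=> spl irr_p px py.
pose G0 := [set u | exists q : {poly F},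
  u = ((map_poly iota q).[x], (map_poly iota q).[y])].
have [|s sA sG] := @partial_iso_field_aut G0 spl.
  split.
  - by move=> a; exists a%:P; rewrite map_polyC !hornerC.
  - by move=> _ _ [q ->] [r ->]; exists (q - r); rewrite rmorphB !hornerE.
  - by move=> _ _ [q ->] [r ->]; exists (q * r); rewrite rmorphM !hornerE.
  - move=> z [q [qx ->]]; have : p %| q.
      by apply: irreducible_dvd_annihilator px _ => //; rewrite rootE -qx.
    move=> /dvdpP[t ->]; by rewrite rmorphM hornerM (eqP py) mulr0.
exists s => //; apply: (sG (x, y)); exists 'X.
by rewrite map_polyX !hornerX.
Qed.

(** The irreducible polynomial of [x] is separable and splits. Were [x] its only root, it would have
    degree 1 and [x] would lie in F; so there is a second root, to which [field_aut_transitive]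
    moves [x]. *)
Lemma field_aut_moves x (p : {poly F}) :
  (forall x, splits_at iota x) -> separable_poly p ->
  root (map_poly iota p) x -> ~ range iota x ->
  exists2 s, field_aut s & s x <> x.
Proof.
move=> spl sep_p px nFx.
have p0 : p != 0 by exact: separable_poly_neq0.
have [r irr_r rx] := irreducible_annihilator p0 px.
have sep_r : separable_poly r.
  by apply: dvdp_separable sep_p; exact: irreducible_dvd_annihilator px.
have [p' _ [p'x [rs prs]]] := spl x.
have /dvdp_prod_XsubC[m eqm] : map_poly iota r %| \prod_(z <- rs) ('X - z%:P).
  rewrite -(eqp_dvdr _ prs) dvdp_map.
  exact: irreducible_dvd_annihilator p'x.
have uq : uniq (mask m rs).
  by rewrite -separable_prod_XsubC -(eqp_separable eqm) separable_map.
have xm : x \in mask m rs by rewrite -root_prod_XsubC -(eqp_root eqm).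
have szm : size (mask m rs) = (size r).-1.
  by rewrite -(size_map_poly iota) (eqp_size eqm) size_prod_XsubC.
have [y] : exists2 y, y \in mask m rs & y != x.
  apply: contrapT => nex; case: nFx.
  have : size (rem x (mask m rs)) = 0%N.
    apply/eqP; rewrite size_eq0 -[_ == _]negbK; apply/negP => /eqP.
    case e : rem => [//|y s] _; case: nex; exists y.
      by apply: (@mem_rem _ x); rewrite e mem_head.
    have := mem_rem_uniqF x uq; rewrite e in_cons => /norP[+ _].
    by rewrite eq_sym.
  rewrite size_rem // szm.
  case: irr_r => sz1 _; case es : (size r) sz1 => [|[|[|k]]] // _ _.
  have := eqP rx; rewrite horner_coef size_map_poly es 2!big_ord_recl big_ord0.
  rewrite /= addr0 expr0 mulr1 expr1 !coef_map => /eqP; rewrite addrC addr_eq0.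
  have r1 : iota r`_1 != 0.
    rewrite fmorph_eq0; have : lead_coef r != 0.
      by rewrite lead_coef_eq0 -size_poly_eq0 es.
    by rewrite /lead_coef es.
  move=> /eqP e; exists (- r`_0 / r`_1) => //.
  by rewrite fmorph_div rmorphN /= -e mulrAC divff ?mul1r.
rewrite -root_prod_XsubC -(eqp_root eqm) => ry ne.
have [s sA sx] := field_aut_transitive spl irr_r rx ry.
by exists s => //; apply/eqP; rewrite sx.
Qed.

End Automorphisms.

(** * Completions and Kummer classes *)

Section PadicIntegers.
Variables (l : nat) (lP : prime l).
Local Notation Zl := (padic_int lP).
Implicit Types a b c : Zl.

Lemma padic_resD a b n : (a + b) n = ((a n + b n) %% (l ^ n)%N)%Z.
Proof. by []. Qed.

Lemma padic_resM a b n : (a * b) n = ((a n * b n) %% (l ^ n)%N)%Z.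
Proof. by []. Qed.

Lemma padic_resN a n : (- a) n = (- a n %% (l ^ n)%N)%Z.
Proof. by []. Qed.

Lemma padic_res1 n : (1 : Zl) n = (1 %% (l ^ n)%N)%Z.
Proof. by []. Qed.

Lemma padic_res_mod a n : (a n %% (l ^ n)%N)%Z = a n.
Proof. exact: res_red. Qed.

Lemma padic_res_nat m n : (m%:R : Zl) n = (m%:Z %% (l ^ n)%N)%Z.
Proof.
elim: m => [|m IHm]; first by rewrite padic_res0 mod0z.
by rewrite -natr1 padic_resD IHm padic_res1 modzDm addrC -intS.
Qed.

Lemma padic_res_int (m : int) n : (m%:~R : Zl) n = (m %% (l ^ n)%N)%Z.
Proof.
case: m => m; first exact: padic_res_nat.
by rewrite NegzE rmorphN padic_resN padic_res_nat modzNm.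
Qed.

Lemma padic_res_mul_eq0 a n : ((l ^ n)%:R * a) n = 0.
Proof. by rewrite padic_resM padic_res_nat modzz mul0r mod0z. Qed.

Lemma padic_res_sub a b n : (a - b) n = 0 <-> a n = b n.
Proof.
rewrite padic_resD padic_resN modzDmr; split=> [e|->]; last by rewrite subrr mod0z.
rewrite -(padic_res_mod a) -(padic_res_mod b); apply/eqP.
by rewrite eqz_mod_dvd; apply/dvdz_mod0P.
Qed.

Lemma padic_res_shift a n m : (a (n + m)%N %% (l ^ n)%N)%Z = a n.
Proof.
elim: m => [|m IHm]; first by rewrite addn0 padic_res_mod.
rewrite -{}IHm addnS [in RHS]padicP; set x := a _.
rewrite [in LHS](divz_eq x (l ^ (n + m))%N).
have e : (l ^ (n + m))%N = (l ^ m)%N%:Z * (l ^ n)%N :> int.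
  by rewrite -PoszM mulnC expnD.
by rewrite [X in _ * X + _]e mulrA modzMDl.
Qed.

Lemma expl_gt0 n : (0 < (l ^ n)%N%:Z)%R.
Proof. by rewrite ltz_nat expn_gt0 prime_gt0. Qed.

Lemma padic_res_ge0 a n : (0 <= a n)%R.
Proof. by rewrite -padic_res_mod modz_ge0 // gt_eqF ?expl_gt0. Qed.

Lemma padic_dvd a n : a n = 0 -> exists b, a = (l ^ n)%:R * b.
Proof.
move=> an0.
have dv m : ((l ^ n)%N%:Z %| a (m + n)%N)%Z by rewrite addnC res_dvd an0.
(* Dividing by l^n loses [n] levels of precision, hence the shift of the index. *)
pose r m := (a (m + n)%N %/ (l ^ n)%N)%Z.
have rE m : a (m + n)%N = (l ^ n)%N%:Z * r m by rewrite mulrC divzK.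
have rP m : r m = (r m.+1 %% (l ^ m)%N)%Z.
  have n0 : (l ^ n)%N%:Z != 0 by rewrite gt_eqF ?expl_gt0.
  apply: (mulfI n0); rewrite -rE mulz_modr ?expl_gt0 // -rE.
  by rewrite -PoszM -expnD [(n + m)%N]addnC addSn -addn1 padic_res_shift.
exists (PadicInt lP rP); apply: padic_ext => m.
rewrite padic_resM padic_res_nat modzMml /= -rE.
by rewrite padic_res_shift.
Qed.

Lemma padic_unit_of_res1 a : a 1%N != 0 -> exists b, b * a = 1.
Proof.
move=> a1; have cop n : coprimez (a n) (l ^ n)%N.
  case: n => [|n]; first by rewrite expn0 /coprimez /gcdz gcdn1.
  rewrite /coprimez /gcdz /=; apply: coprimeXr.
  rewrite coprime_sym prime_coprime //; apply: contra a1 => dv.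
  rewrite -(padic_res_shift a 1 n) add1n expn1.
  by apply/eqP/dvdz_mod0P; rewrite dvdzE.
have inv n : exists u, (u * a n)%Z = 1 %[mod (l ^ n)%N]%Z.
  have [[u v] e] : exists uv, uv.1 * a n + uv.2 * (l ^ n)%N%:Z = 1.
    by case/coprimezP: (cop n) => uv; exists uv.
  by exists u; rewrite -e /= addrC modzMDl.
pose r n := (projT1 (cid (inv n)) %% (l ^ n)%N)%Z.
have rE n : (r n * a n)%Z = 1 %[mod (l ^ n)%N]%Z.
  by rewrite /r modzMml; exact: projT2 (cid (inv n)).
have rP n : r n = (r n.+1 %% (l ^ n)%N)%Z.
  have e : (r n.+1 * a n)%Z = 1 %[mod (l ^ n)%N]%Z.
    rewrite [a n]padicP modzMmr; apply/eqP; rewrite eqz_mod_dvd.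
    move/eqP: (rE n.+1); rewrite eqz_mod_dvd; apply: dvdz_trans.
    by rewrite expnS PoszM dvdz_mull.
  have <- : (r n %% (l ^ n)%N)%Z = r n by rewrite /r modz_mod.
  apply/eqP; rewrite eqz_mod_dvd -(@Gauss_dvdzl _ _ (a n)); last first.
    by rewrite coprimez_sym.
  by rewrite mulrBl -eqz_mod_dvd rE e.
by exists (PadicInt lP rP); apply: padic_ext => n; rewrite padic_resM rE.
Qed.

Lemma padic_unit_or_dvd a : (exists b, b * a = 1) \/ (exists b, a = l%:R * b).
Proof.
have [a1|/padic_unit_of_res1] := eqVneq (a 1%N) 0; last by left.
by right; have [b] := padic_dvd a1; rewrite expn1; exists b.
Qed.

Lemma padic_dvd_eq0 a : (forall n, exists b, a = (l ^ n)%:R * b) -> a = 0.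
Proof.
move=> dv; apply: padic_ext => n; have [b ->] := dv n.
by rewrite padic_res_mul_eq0 padic_res0.
Qed.

Lemma padic_factor a : a != 0 -> exists n u v, v * u = 1 /\ a = (l ^ n)%:R * u.
Proof.
move=> a0; have ex : exists n, a n != 0.
  apply: contrapT => nex; case/eqP: a0; apply: padic_ext => n.
  by rewrite padic_res0; apply/eqP; apply: contraT => an; case: nex; exists n.
case: (ex_minnP ex) => -[|n] an minn.
  by move: an; rewrite -padic_res_mod modz1.
have /padic_dvd[b ab] : a n = 0.
  by apply/eqP; apply: contraT => /minn; rewrite ltnn.
exists n, b; have [[v vb]|[c bc]] := padic_unit_or_dvd b; first by exists v.
move: an; rewrite ab bc mulrA -natrM -expnSr.
by rewrite padic_res_mul_eq0 eqxx.
Qed.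

Lemma padic_natl_neq0 n : ((l ^ n)%:R : Zl) != 0.
Proof.
apply/eqP => /(congr1 (fun a : Zl => a n.+1)).
rewrite padic_res_nat padic_res0 modz_small.
  by case=> /eqP; rewrite expn_eq0 eqn0Ngt prime_gt0.
by rewrite /= ltz_nat ltn_exp2l ?prime_gt1.
Qed.

End PadicIntegers.

(** * Torsion and divisibility in the completion *)

Section CompletionTheory.
Variables (l : nat) (lP : prime l) (A : zmodType).
Local Notation Zl := (padic_int lP).
Local Notation H := (completion A lP).
Local Notation pi n := (\pi_(lquot l A n)%qT).
Implicit Types (x y : H) (a : A).

Lemma comp_res0 n : (0 : H) n = 0. Proof. by []. Qed.
Lemma comp_resD x y n : (x + y) n = x n + y n. Proof. by []. Qed.
Lemma comp_resN x n : (- x) n = - x n. Proof. by []. Qed.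

Lemma comp_resMn x m n : (x *+ m) n = x n *+ m.
Proof. by elim: m => [|m IHm]; rewrite ?mulr0n // !mulrS comp_resD IHm. Qed.

Lemma comp_lift x n : exists a, pi n a = x n.
Proof. by exists (repr (x n)); rewrite reprK. Qed.

Lemma comp_lift_le x n m a : pi (n + m)%N a = x (n + m)%N -> pi n a = x n.
Proof.
elim: m => [|m IHm]; first by rewrite addn0.
by rewrite addnS => e; apply: IHm; rewrite compP -e lproj_pi.
Qed.

Lemma lquot_eq0 n a : pi n a = 0 <-> exists b, a = b *+ (l ^ n).
Proof.
rewrite -(raddf0 (pi n)); split.
  by move=> /lquot_piE/asboolP[b]; rewrite subr0 => ->; exists b.
by move=> [b ->]; apply/lquot_piE/asboolP; exists b; rewrite subr0.
Qed.

Lemma lquot_eq n a a' : pi n a = pi n a' <-> exists b, a = a' + b *+ (l ^ n).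
Proof.
split=> [/lquot_piE/asboolP[b e]|[b ->]]; first by exists b; rewrite -e addrC subrK.
by apply/lquot_piE/asboolP; exists b; rewrite addrAC subrr add0r.
Qed.

Lemma comp_res_mulln x n : (x *+ (l ^ n)) n = 0.
Proof.
rewrite comp_resMn; have [a <-] := comp_lift x n.
by rewrite -raddfMn; apply/lquot_eq0; exists a.
Qed.

Hypothesis tors_div : forall a k n, a *+ (l ^ k) = 0 ->
  exists b, a = b *+ (l ^ n).

(** Division by l^k is not unique in A, but [a] and [b *+ (l ^ n)] differ by torsion, which
    [tors_div] makes divisible by l^n. So the quotient is well defined modulo l^n, which is all that
    the completion sees. *)
Let mulln_div a b k n : a *+ (l ^ k) = b *+ (l ^ (n + k)) ->
  exists c, a = c *+ (l ^ n).
Proof.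
move=> e; have [|c ec] := @tors_div (a - b *+ (l ^ n)) k n.
  by rewrite mulrnBl -mulrnA -expnD e subrr.
by exists (c + b); rewrite mulrnDl -ec subrK.
Qed.

Lemma comp_mulln_inj x k : x *+ (l ^ k) = 0 -> x = 0.
Proof.
move=> e; apply: comp_ext => n; have [a ax] := comp_lift x (n + k)%N.
rewrite -(comp_lift_le ax); apply/lquot_eq0.
have /(congr1 (fun y : H => y (n + k)%N)) := e.
rewrite comp_resMn -ax -raddfMn => /lquot_eq0[b].
exact: mulln_div.
Qed.

Lemma comp_torsion_free (c : Zl) x : c != 0 -> c *: x = 0 -> x = 0.
Proof.
move=> c0; have [n [u [v [vu ->]]]] := padic_factor c0.
rewrite -scalerA scaler_nat => /comp_mulln_inj/(congr1 ( *:%R v)).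
by rewrite scalerA vu scale1r scaler0.
Qed.

(** [x (k + n)] is divisible by l^k because [x k = 0], and by [mulln_div] the quotient is determined
    modulo l^n; these quotients are the components of [y]. *)
Lemma comp_div x k : x k = 0 -> exists y, x = y *+ (l ^ k).
Proof.
move=> xk0; have ex n : exists b, pi (k + n)%N (b *+ (l ^ k)) = x (k + n)%N.
  have [a ax] := comp_lift x (k + n)%N.
  have /lquot_eq0[b ab] := etrans (comp_lift_le ax) xk0.
  by exists b; rewrite -ab.
pose b n := projT1 (cid (ex n)).
have bE n : pi (k + n)%N (b n *+ (l ^ k)) = x (k + n)%N := projT2 (cid (ex n)).
have bP n : pi n (b n) = lproj (pi n.+1 (b n.+1)).
  rewrite lproj_pi; apply/lquot_eq.
  have : pi (k + n)%N (b n *+ (l ^ k)) = pi (k + n)%N (b n.+1 *+ (l ^ k)).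
    rewrite bE; apply/esym/(@comp_lift_le _ _ 1); rewrite addn1 -addnS; exact: bE.
  move=> /lquot_eq[c e]; have [|d ed] := @mulln_div (b n - b n.+1) c k n.
    by rewrite mulrnBl e addrAC subrr add0r addnC.
  by exists d; rewrite -ed addrC subrK.
exists (Completion lP bP); apply: comp_ext => n; rewrite comp_resMn /=.
rewrite -raddfMn; apply/esym/(@comp_lift_le _ _ k).
by rewrite addnC; exact: bE.
Qed.

End CompletionTheory.

(* The hypotheses are those of Kummer theory: A is F^*, C is the multiplicative
   group of an extension, written additively, and z is a compatible system of
   primitive roots of unity of l-power order. *)
Section KummerPairing.
Variables (l : nat) (lP : prime l) (A C : zmodType) (io : {additive A -> C}).
Local Notation Zl := (padic_int lP).
Local Notation H := (completion A lP).
Local Notation pi n := (\pi_(lquot l A n)%qT).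
Implicit Types (x y : H) (a : A) (b : C) (u v : Zl).

Definition kummer_system (z : nat -> A) :=
  [/\ injective io, forall k, z k.+1 *+ l = z k,
      forall k b, b *+ (l ^ k) = 0 -> exists j : int, b = io (z k *~ j)
    & forall k (j : int), z k *~ j = 0 <-> ((l ^ k)%N %| j)%Z].

(** Under [zK] two such [b] for the same [x] and [k] differ by an element of the image of A: a
    change of representative shifts the root by such an element, up to a root of unity that comes
    from A too. *)
Definition kroot x k b : Prop :=
  exists2 a, b *+ (l ^ k) = io a & pi k a = x k.

Variable z : nat -> A.
Hypothesis zK : kummer_system z.

Let io_inj : injective io. Proof. by case: zK. Qed.

Lemma zeta_shift k n : z (k + n)%N *+ (l ^ n) = z k.
Proof.
case: zK => _ zS _ _; elim: n => [|n IHn]; first by rewrite addn0.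
by rewrite addnS expnS mulrnA zS.
Qed.

Lemma kummer_torsion b k : b *+ (l ^ k) = 0 -> exists j : int, b = io (z k *~ j).
Proof. by case: zK => _ _ + _; exact. Qed.

Lemma zeta_eq0 k (j : int) : z k *~ j = 0 <-> ((l ^ k)%N %| j)%Z.
Proof. by case: zK => _ _ _; exact. Qed.

Lemma zeta_torsion k (j : int) : (z k *~ j) *+ (l ^ k) = 0.
Proof. by rewrite pmulrn -mulrzA; apply/zeta_eq0; rewrite dvdz_mull. Qed.

Lemma zeta_mod k (j : int) : z k *~ (j %% (l ^ k)%N)%Z = z k *~ j.
Proof.
apply/eqP; rewrite -subr_eq0 -mulrzBr; apply/eqP/zeta_eq0.
by rewrite -eqz_mod_dvd modz_mod.
Qed.

Lemma zeta_inj k u v : z k *~ u k = z k *~ v k -> u k = v k.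
Proof.
move=> /eqP; rewrite -subr_eq0 -mulrzBr => /eqP/zeta_eq0.
by rewrite -eqz_mod_dvd !padic_res_mod => /eqP.
Qed.

Lemma base_torsion_div a k n : a *+ (l ^ k) = 0 -> exists a', a = a' *+ (l ^ n).
Proof.
move=> ak; have [|j] := @kummer_torsion (io a) k.
  by rewrite -raddfMn ak raddf0.
move=> /io_inj ->; exists (z (k + n)%N *~ j).
by rewrite -(zeta_shift k n) !pmulrn -!mulrzA [in RHS]mulrC.
Qed.

Lemma kroot_add x y k b c : kroot x k b -> kroot y k c -> kroot (x + y) k (b + c).
Proof.
move=> [a ba ax] [a' ca' ay]; exists (a + a').
  by rewrite mulrnDl ba ca' raddfD.
by rewrite raddfD /= ax ay.
Qed.

Lemma kroot_scale (c : Zl) x k b : kroot x k b -> kroot (c *: x) k (b *~ c k).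
Proof.
move=> [a ba ax]; exists (a *~ c k); last by rewrite raddfMz /= ax.
by rewrite raddfMz -ba !pmulrn -!mulrzA [in RHS]mulrC.
Qed.

Lemma kroot_opp x k b : kroot x k b -> kroot (- x) k (- b).
Proof.
by move=> [a ba ax]; exists (- a); rewrite ?raddfN /= ?ax // mulNrn ba.
Qed.

Lemma kroot_sub x y k b c : kroot x k b -> kroot y k c -> kroot (x - y) k (b - c).
Proof. by move=> xb /kroot_opp; exact: kroot_add. Qed.

Lemma kroot_io k a : kroot 0 k (io a).
Proof.
exists (a *+ (l ^ k)); first by rewrite raddfMn.
by rewrite comp_res0; apply/lquot_eq0; exists a.
Qed.

Lemma kroot0 k b : kroot 0 k b -> exists a, b = io a.
Proof.
move=> [a ba]; rewrite comp_res0 => /lquot_eq0[c ac].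
have [|j e] := @kummer_torsion (b - io c) k.
  by rewrite mulrnBl ba ac raddfMn subrr.
by exists (z k *~ j + c); rewrite raddfD -e subrK.
Qed.

(** [x *+ (l ^ n)] at level [k + n] depends only on [x] at level [k]. The same [b] can thus be seen
    at any higher level, which is how two roots are brought to a common one. *)
Lemma kroot_shift x k n b : kroot x k b -> kroot (x *+ (l ^ n)) (k + n)%N b.
Proof.
move=> [a ba ax]; have [a' a'x] := comp_lift x (k + n)%N.
have /lquot_eq[c e] := etrans ax (esym (comp_lift_le a'x)).
exists (a' *+ (l ^ n) + c *+ (l ^ (k + n))).
  by rewrite expnD !mulrnA ba e -raddfMn mulrnDl.
rewrite comp_resMn -a'x -raddfMn; by apply/lquot_eq; exists c.
Qed.

Lemma kroot_unshift x k n b : kroot x (k + n)%N b -> kroot x k (b *+ (l ^ n)).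
Proof.
move=> [a ba /comp_lift_le ax]; exists a => //.
by rewrite -mulrnA -expnD addnC.
Qed.

Lemma kroot_fun x y k b : kroot x k b -> kroot y k b -> x k = y k.
Proof. by move=> [a ba <-] [a' + <-]; rewrite ba => /io_inj ->. Qed.

Lemma kroot_io_eq0 x k a : kroot x k (io a) -> x k = 0.
Proof. by move=> xa; rewrite (kroot_fun xa (kroot_io k a)). Qed.

Lemma kroot_exists x k : (forall b, exists c, c *+ l = b) -> exists b, kroot x k b.
Proof.
move=> dv; have [a ax] := comp_lift x k.
have [b ba] : exists b, b *+ (l ^ k) = io a.
  elim: k {ax} (io a) => [|k IHk] c; first by exists c.
  have [b bc] := IHk c; have [d db] := dv b.
  by exists d; rewrite expnS mulrnA db.
by exists b, a.
Qed.

Definition rooted x := forall k, exists b, kroot x k b.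

(** The Kummer pairing of [s] and [x], with value in Z_l through the generator [z] of the Tate
    module. A level without roots imposes no condition, whence the assumption [rooted] in
    [kchar_unique]. *)
Definition kchar (s : C -> C) x u :=
  forall k b, kroot x k b -> s b = b + io (z k *~ u k).

Lemma rooted_scale (c : Zl) x : rooted x -> rooted (c *: x).
Proof.
by move=> xr k; have [b xb] := xr k; exists (b *~ c k); exact: kroot_scale.
Qed.

Lemma rooted_add x y : rooted x -> rooted y -> rooted (x + y).
Proof.
move=> xr yr k; have [[b xb] [c yc]] := (xr k, yr k).
by exists (b + c); exact: kroot_add.
Qed.

Lemma rooted0 : rooted 0.
Proof. by move=> k; exists (io 0); exact: kroot_io. Qed.

(** The same [b] works: [b *+ (l ^ k)] differs from a representative of [x k] by an element of
    l^n-torsion, which comes from A and is there divisible by l^k. *)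
Lemma rooted_div x n : rooted (x *+ (l ^ n)) -> rooted x.
Proof.
move=> xr k; have [b xb] := xr (k + n)%N; exists b.
have [a ba ax] := xb; have [a' a'x] := comp_lift x (k + n)%N.
move: ax; rewrite comp_resMn -a'x -raddfMn => /lquot_eq[c ac].
have [|j e] := @kummer_torsion (b *+ (l ^ k) - io (a' + c *+ (l ^ k))) n.
  rewrite mulrnBl -mulrnA -expnD ba ac -raddfMn mulrnDl -mulrnA -expnD.
  by rewrite subrr.
have [|w ew] := @base_torsion_div (z n *~ j) n k; first exact: zeta_torsion.
exists (w *+ (l ^ k) + (a' + c *+ (l ^ k))).
  by rewrite raddfD -ew -e subrK.
rewrite -(comp_lift_le a'x) addrCA -mulrnDl; apply/lquot_eq; by exists (w + c).
Qed.

Section OneAutomorphism.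
Variable s : {additive C -> C}.
Hypothesis s_io : forall a, s (io a) = io a.

Lemma kcharP x u : (forall k, exists2 b, kroot x k b & s b = b + io (z k *~ u k)) ->
  kchar s x u.
Proof.
move=> ex k b xb; have [c xc sc] := ex k.
have [a e] : exists a, b - c = io a.
  by apply: (@kroot0 k); rewrite -(subrr x); exact: kroot_sub.
by rewrite -(subrK c b) e raddfD /= s_io sc addrA.
Qed.

Lemma kchar_unique x u v : rooted x -> kchar s x u -> kchar s x v -> u = v.
Proof.
move=> xr xu xv; apply: padic_ext => k; have [b xb] := xr k.
apply: zeta_inj; apply/io_inj/(addrI b).
by rewrite -(xu _ _ xb) -(xv _ _ xb).
Qed.

(** [s b - b] is killed by l^k, hence a multiple of [z k]. The exponents are compatible because
    [b *+ l] is a root at level [k] when [b] is one at level [k.+1]. *)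
Lemma kchar_exists x : rooted x -> exists u, kchar s x u.
Proof.
move=> xr; have exj k : exists bj : C * int,
    kroot x k bj.1 /\ s bj.1 = bj.1 + io (z k *~ bj.2).
  have [b xb] := xr k; have [|j e] := @kummer_torsion (s b - b) k.
    have [a ba _] := xb.
    by rewrite mulrnBl -raddfMn ba s_io subrr.
  by exists (b, j); split=> //=; rewrite -e addrC subrK.
pose j k := (projT1 (cid (exj k))).2.
have jE k b : kroot x k b -> s b = b + io (z k *~ j k).
  move=> xb; rewrite /j; case: cid => -[c i] /= [xc sc].
  have [a e] : exists a, b - c = io a.
    by apply: (@kroot0 k); rewrite -(subrr x); exact: kroot_sub.
  by rewrite -(subrK c b) e raddfD /= s_io sc addrA.
pose r k := (j k %% (l ^ k)%N)%Z.
have rP k : r k = (r k.+1 %% (l ^ k)%N)%Z.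
  have [b xb] := xr k.+1.
  have xbl : kroot x k (b *+ l).
    by rewrite -[X in b *+ X]expn1; apply: kroot_unshift; rewrite addn1.
  have := jE _ _ xbl; rewrite raddfMn /= (jE _ _ xb) mulrnDl -raddfMn /=.
  move=> /addrI/io_inj; rewrite pmulrn -mulrzA mulrC mulrzA -pmulrn.
  case: zK => _ -> _ _ /eqP; rewrite -subr_eq0 -mulrzBr => /eqP/zeta_eq0.
  rewrite -eqz_mod_dvd => /eqP e.
  by rewrite -[LHS]e; apply/esym; exact: padic_redS.
exists (PadicInt lP rP) => k b /jE ->.
by rewrite /= /r zeta_mod.
Qed.

Lemma kchar_add x y u v : rooted x -> rooted y ->
  kchar s x u -> kchar s y v -> kchar s (x + y) (u + v).
Proof.
move=> xr yr xu yv; apply: kcharP => k; have [[b xb] [c yc]] := (xr k, yr k).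
exists (b + c); first exact: kroot_add.
rewrite raddfD /= (xu _ _ xb) (yv _ _ yc) addrACA -raddfD /=.
by rewrite zeta_mod mulrzDr.
Qed.

Lemma kchar_scale (c : Zl) x u :
  rooted x -> kchar s x u -> kchar s (c *: x) (c * u).
Proof.
move=> xr xu; apply: kcharP => k; have [b xb] := xr k.
exists (b *~ c k); first exact: kroot_scale.
rewrite raddfMz /= (xu _ _ xb) mulrzDl -raddfMz /=.
by rewrite zeta_mod mulrC mulrzA.
Qed.

Lemma kchar0 : kchar s 0 0.
Proof.
move=> k b /kroot0[a ->].
by rewrite padic_res0 mulr0z raddf0 addr0 s_io.
Qed.

Lemma kchar_fixed x k b : kchar s x 0 -> kroot x k b -> s b = b.
Proof. by move=> xs /xs ->; rewrite padic_res0 mulr0z raddf0 addr0. Qed.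

Lemma kchar_comp (t : C -> C) x u v : kchar s x u -> kchar t x v ->
  kchar (s \o t) x (u + v).
Proof.
move=> xu xv k b xb /=; rewrite (xv _ _ xb) raddfD /= s_io (xu _ _ xb).
by rewrite -addrA -raddfD /= -mulrzDr zeta_mod addrC.
Qed.

End OneAutomorphism.

End KummerPairing.

(** * Subspaces and lattices *)

Section FractionTensor.
Variables (R : idomainType) (M : lmodType R).
Local Notation frac := (@FracField.tofrac R).
Local Notation V := (tensor frac M).

Definition unit_tensor (x : M) : V := @pure_tensor R {fraction R} frac M 1 x.

Lemma frac_denom (a : {fraction R}) :
  exists (D : R) r, D != 0 /\ frac D * a = frac r.
Proof.
elim/quotW: a => -[[n d] /= d0]; exists d, n; split=> //.
unlock FracField.tofrac; rewrite -[LHS]FracField.pi_mul.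
apply/eqmodP => /=; rewrite /FracField.equivf /FracField.mulf /=.
by rewrite !numden_Ratio ?mul1r ?mulr1 ?oner_neq0.
Qed.

Lemma pure_tensorDr a (m n : M) :
  pure_tensor frac a (m + n) = pure_tensor frac a m + pure_tensor frac a n.
Proof.
rewrite /pure_tensor -tensor_piD; apply/tensor_piE/asboolP => S _; apply.
by apply: Or32; exists a, m, n; rewrite opprD addrA.
Qed.

Lemma pure_tensorZ a r (m : M) :
  pure_tensor frac (a * frac r) m = pure_tensor frac a (r *: m).
Proof.
rewrite /pure_tensor; apply/tensor_piE/asboolP => S _; apply.
by apply: Or33; exists a, r, m.
Qed.

Lemma scale_pure_tensor b a (m : M) :
  b *: pure_tensor frac a m = pure_tensor frac (b * a) m.
Proof. exact: tensor_scale_pure. Qed.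

Fact unit_tensor_is_additive : zmod_morphism unit_tensor.
Proof.
move=> x y; apply: (addIr (unit_tensor y)).
by rewrite /unit_tensor -pure_tensorDr !subrK.
Qed.

HB.instance Definition _ :=
  GRing.isZmodMorphism.Build M V unit_tensor unit_tensor_is_additive.

Lemma unit_tensorZ r x : unit_tensor (r *: x) = frac r *: unit_tensor x.
Proof. by rewrite /unit_tensor scale_pure_tensor mulr1 -pure_tensorZ mul1r. Qed.

Lemma tensor_denom (v : V) :
  exists (D : R) x, D != 0 /\ frac D *: v = unit_tensor x.
Proof.
pose Q (u : V) := exists (D : R) x, D != 0 /\ frac D *: u = unit_tensor x.
have QD u w : Q u -> Q w -> Q (u + w).
  move=> [D [x [D0 eu]]] [D' [y [D'0 ew]]].
  exists (D * D'), (D' *: x + D *: y); rewrite mulf_neq0 //; split=> //.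
  rewrite [unit_tensor _]raddfD scalerDr /= !unit_tensorZ -eu -ew.
  rewrite !scalerA -!tofracM.
  by rewrite [D' * D]mulrC.
have QMz u k : Q u -> Q (u *~ k).
  move=> [D [x [D0 eu]]]; exists D, (x *~ k); split=> //.
  by rewrite raddfMz /= eu -raddfMz.
elim/quotW: v => X; rewrite -(freeg_sumE X).
rewrite (raddf_sum (\pi_(Quotient.quot (tensor_null (M := M) frac)))%qT).
apply: (big_ind Q) => [|//|[a m] _].
  by exists 1, 0; rewrite oner_neq0 scaler0 raddf0.
have -> : << coeff (a, m) X *g (a, m) >> = << (a, m) >> *~ coeff (a, m) X
    :> {freeg ({fraction R} * M)%type}.
  by rewrite freeg_mulz intz.
rewrite raddfMz; apply: QMz; have [D [r [D0 e]]] := frac_denom a.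
exists D, (r *: m); split=> //.
by rewrite -[LHS]/(frac D *: pure_tensor frac a m) scale_pure_tensor e
  unit_tensorZ scale_pure_tensor mulr1.
Qed.

Hypothesis torsion_free : forall (r : R) (x : M), r != 0 -> r *: x = 0 -> x = 0.

(* Multiplying by a common denominator E of all the coefficients occurring in a
   formal sum maps it to an element of M, which is zero on the relations of
   the tensor product as soon as E is sufficiently divisible. *)
Lemma unit_tensor_inj : injective unit_tensor.
Proof.
apply: raddf_inj => x.
rewrite /unit_tensor -(raddf0 (\pi_(Quotient.quot (tensor_null (M := M) frac)))%qT).
move=> /tensor_piE/asboolP null.
pose rho (a : {fraction R}) : R :=
  if pselect (exists r, a = frac r) is left ex then projT1 (cid ex) else 0.
have rhoE r : rho (frac r) = r.
  rewrite /rho; case: pselect => [ex|[]]; last by exists r.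
  by case: cid => r' /= /eqP; rewrite tofrac_eq => /eqP.
pose T E : {freeg ({fraction R} * M)%type} -> zmodule M :=
  fglift (fun am => rho (frac E * am.1) *: am.2 : zmodule M).
have TU E a m : T E << (a, m) >> = rho (frac E * a) *: m.
  by rewrite /T liftU scale1r.
have TB E X Y : T E (X - Y) = T E X - T E Y by exact: lift_is_additive.
(* The condition runs over all multiples [E * D], so that the product of two denominators serves for
   both; this makes [S] closed under subtraction. *)
pose S : {pred {freeg ({fraction R} * M)%type}} := fun X =>
  `[< exists2 D, D != 0 & forall E, T (E * D) X = 0 >].
have T0 E : T E 0 = 0 by rewrite -(subrr 0) TB subrr.
have /asboolP[D D0 /(_ 1)] : << (1, x) >> - 0 \in S.
  apply: null => [|y].
    split=> [|X Y]; rewrite !unfold_in.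
      by apply/asboolP; exists 1; [exact: oner_neq0|move=> E; exact: T0].
    move=> /asboolP[D D0 XD] /asboolP[D' D'0 YD'].
    apply/asboolP; exists (D * D') => [|E]; first by rewrite mulf_neq0.
    by rewrite TB mulrA YD' mulrAC XD subrr.
  rewrite unfold_in => rel; apply/asboolP.
  case: rel => [[a [a' [m ->]]]|[a [m [m' ->]]]|[a [r [m ->]]]].
  - have [D [r [D0 aD]]] := frac_denom a; have [D' [r' [D'0 a'D]]] := frac_denom a'.
    exists (D * D') => [|E]; first by rewrite mulf_neq0.
    have e1 : frac (E * (D * D')) * a = frac (E * D' * r).
      by rewrite [D * D']mulrC mulrA tofracM -mulrA aD -tofracM.
    have e2 : frac (E * (D * D')) * a' = frac (E * D * r').
      by rewrite mulrA tofracM -mulrA a'D -tofracM.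
    rewrite !TB !TU mulrDr e1 e2 -tofracD !rhoE.
    by rewrite scalerDl -addrA -opprD subrr.
  - exists 1 => [|E]; first exact: oner_neq0.
    by rewrite !TB !TU scalerDr -addrA -opprD subrr.
  - have [D [s [D0 aD]]] := frac_denom a; exists D => // E.
    rewrite !TB !TU mulrA tofracM -[_ * a]mulrA aD -!tofracM !rhoE.
    by rewrite scalerA subrr.
rewrite TB T0 subr0 mul1r TU mulr1 rhoE; exact: torsion_free.
Qed.

End FractionTensor.

Section LinearAlgebra.
Variables (k : fieldType) (V : lmodType k).

Definition lin_indep m (u : 'I_m -> V) :=
  forall c : 'I_m -> k, \sum_i c i *: u i = 0 -> forall i, c i = 0.

Lemma comb_mulmx m d (u : 'I_m -> V) (w : 'I_d -> V) (A : 'M[k]_(m, d)) :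
  (forall i, u i = \sum_j A i j *: w j) -> forall x : 'rV_m,
  \sum_i x 0 i *: u i = \sum_j (x *m A) 0 j *: w j.
Proof.
move=> uA x; under eq_bigr do rewrite uA scaler_sumr.
rewrite exchange_big; apply: eq_bigr => j _; rewrite mxE scaler_suml.
by apply: eq_bigr => i _; rewrite scalerA.
Qed.

Lemma lin_indep_row_free m d (u : 'I_m -> V) (w : 'I_d -> V) (A : 'M[k]_(m, d)) :
  (forall i, u i = \sum_j A i j *: w j) -> lin_indep u -> row_free A.
Proof.
move=> uA ind; rewrite -kermx_eq0; apply/eqP/row_matrixP => i.
have := mulmx_ker A => /(congr1 (row i)); rewrite row_mul row0 => e.
rewrite row0; apply/rowP => j; rewrite [RHS]mxE.
apply: (ind (fun j => row i (kermx A) 0 j)).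
by rewrite (comb_mulmx uA) e; apply: big1 => t _; rewrite mxE scale0r.
Qed.

Lemma comb_mx m d (u : 'I_m -> V) (w : 'I_d -> V) :
  (forall i, exists c : 'I_d -> k, u i = \sum_j c j *: w j) ->
  exists A : 'M[k]_(m, d), forall i, u i = \sum_j A i j *: w j.
Proof.
move=> /choice[c uc]; exists (\matrix_(i, j) c i j) => i.
by rewrite uc; apply: eq_bigr => j _; rewrite mxE.
Qed.

Lemma lin_indep_leq m d (u : 'I_m -> V) (w : 'I_d -> V) :
  (forall i, exists c : 'I_d -> k, u i = \sum_j c j *: w j) ->
  lin_indep u -> (m <= d)%N.
Proof.
move=> /comb_mx[A uA] /(lin_indep_row_free uA)/eqP <-.
exact: rank_leq_col.
Qed.

Lemma Grass_sub_eq d (W W' : set V) :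
  Grass d V W -> Grass d V W' -> W `<=` W' -> W = W'.
Proof.
move=> [_ [b [ind eW]]] [_ [b' [_ eW']]] sub; apply/seteqP; split=> // v.
have [A bA] : exists A : 'M[k]_d, forall i, b i = \sum_j A i j *: b' j.
  apply: comb_mx => i; have : W' (b i).
    apply: sub; rewrite eW; exists (fun j => (j == i)%:R) => //.
    rewrite (bigD1 i) //= eqxx scale1r big1 ?addr0 // => j /negPf ->.
    by rewrite scale0r.
  by rewrite eW' => -[c _ <-]; exists c.
have uA : A \in unitmx by rewrite -row_free_unit; exact: lin_indep_row_free bA ind.
rewrite eW' eW => -[c _ <-].
exists (fun i => ((\row_j c j) *m invmx A) 0 i) => //.
rewrite (comb_mulmx bA) mulmxKV //.
by apply: eq_bigr => j _; rewrite mxE.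
Qed.

End LinearAlgebra.

(** * Saturated lattices and the subspaces that they span *)

Section Lattices.
Variables (l : nat) (lP : prime l) (A : zmodType).
Local Notation Zl := (padic_int lP).
Local Notation Ql := (padic_num lP).
Local Notation frac := (@FracField.tofrac Zl).
Local Notation H := (completion A lP).
Local Notation V := (tensor frac H).
Local Notation one := (@unit_tensor Zl H).
Implicit Types (M : set H) (W : set V).

Hypothesis tors_div : forall (a : A) k n, a *+ (l ^ k) = 0 ->
  exists b, a = b *+ (l ^ n).

Let torsion_free (r : Zl) (x : H) : r != 0 -> r *: x = 0 -> x = 0.
Proof. exact: comp_torsion_free. Qed.

Let one_inj : injective one.
Proof. exact: unit_tensor_inj. Qed.

Let one_sum m (c : 'I_m -> Zl) (e : 'I_m -> H) :
  one (\sum_i c i *: e i) = \sum_i frac (c i) *: one (e i).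
Proof. by rewrite raddf_sum; apply: eq_bigr => i _; rewrite /= unit_tensorZ. Qed.

(** For a submodule [M] this is the subspace spanned by [M]: one denominator serves for a whole
    linear combination. *)
Definition lattice_span M : set V :=
  [set v | exists (D : Zl) x, [/\ D != 0, M x & frac D *: v = one x]].

(** The last clause says that H / M is torsion-free; it lets [M] be recovered as the intersection of
    H with its span, in [lattice_span_unit]. *)
Definition saturated M := [/\ M 0, forall x y, M x -> M y -> M (x + y),
  forall (c : Zl) x, M x -> M (c *: x)
  & forall (c : Zl) x, c != 0 -> M (c *: x) -> M x].

Definition zbasis d M (e : 'I_d -> H) :=
  [/\ forall i, M (e i),
      forall x, M x -> exists c : 'I_d -> Zl, x = \sum_i c i *: e i
    & forall c : 'I_d -> Zl, \sum_i c i *: e i = 0 -> forall i, c i = 0].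

Lemma saturated_comb d M (e : 'I_d -> H) (c : 'I_d -> Zl) :
  saturated M -> (forall i, M (e i)) -> M (\sum_i c i *: e i).
Proof.
move=> [M0 MD MZ _] Me; elim/big_ind: _ => // i _; exact: MZ.
Qed.

Lemma lattice_span_unit M x : saturated M -> lattice_span M (one x) <-> M x.
Proof.
move=> [M0 MD MZ MS]; split=> [[D [y [D0 My]]]|Mx]; last first.
  by exists 1, x; rewrite oner_neq0 tofrac1 scale1r.
by rewrite -unit_tensorZ => /one_inj e; apply: (MS D) => //; rewrite e.
Qed.

Lemma common_denom m (c : 'I_m -> Ql) :
  exists (D : Zl) (r : 'I_m -> Zl), D != 0 /\ forall i, frac D * c i = frac (r i).
Proof.
have /choice[D /choice[r Dr]] := fun i => frac_denom (c i).
exists (\prod_i D i), (fun i => (\prod_(j | j != i) D j) * r i).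
split=> [|i]; first by apply/prodf_neq0 => i _; case: (Dr i).
rewrite (bigD1 i) //= [D i * _]mulrC !tofracM -mulrA.
by case: (Dr i) => _ ->.
Qed.

Lemma indep_unit_tensor m (e : 'I_m -> H) :
  (forall c : 'I_m -> Zl, \sum_i c i *: e i = 0 -> forall i, c i = 0) ->
  lin_indep (fun i => one (e i)).
Proof.
move=> ind c e0 i; have [D [r [D0 Dr]]] := common_denom c.
have /ind/(_ i) : \sum_i r i *: e i = 0.
  apply: one_inj; rewrite one_sum raddf0.
  have e1 : frac D *: (\sum_i c i *: one (e i)) = 0 by rewrite e0 scaler0.
  rewrite -[RHS]e1 scaler_sumr.
  by apply: eq_bigr => j _; rewrite scalerA Dr.
move=> ri; have := Dr i; rewrite ri tofrac0 => /eqP.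
by rewrite mulf_eq0 tofrac_eq0 (negPf D0) => /eqP.
Qed.

Lemma Grass_lattice_span d M (e : 'I_d -> H) :
  saturated M -> zbasis M e -> Grass d V (lattice_span M).
Proof.
move=> Msat [Me Mgen ind]; have [M0 MD MZ MS] := Msat.
split.
  split=> [|a u v]; rewrite !inE /=.
    by exists 1, 0; rewrite oner_neq0 scaler0 raddf0.
  move=> [D [x [D0 Mx eu]]] [D' [y [D'0 My ev]]].
  have [E [r [E0 Er]]] := frac_denom a.
  exists (E * D * D'), ((r * D') *: x + (E * D) *: y).
  rewrite !mulf_neq0 //; split=> //; first by apply: MD; exact: MZ.
  rewrite [RHS]raddfD /= !unit_tensorZ -eu -ev scalerDr !scalerA -!tofracM.
  congr (_ *: u + _).
  have -> : E * D * D' = D' * D * E by rewrite [RHS]mulrC mulrA mulrAC.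
  rewrite [frac (_ * E)]tofracM -[LHS]mulrA Er -!tofracM; congr frac.
  by rewrite mulrC mulrA.
exists (fun i => one (e i)); split; first exact: indep_unit_tensor.
apply/seteqP; split=> [v [D [x [D0 /Mgen[c ->] ev]]]|_ [c _ <-]].
  exists (fun i => (frac D)^-1 * frac (c i)) => //.
  under eq_bigr do rewrite -scalerA.
  rewrite -scaler_sumr -one_sum -ev scalerA mulVf ?scale1r //.
  by rewrite tofrac_eq0.
have [D [r [D0 Dr]]] := common_denom c.
exists D, (\sum_i r i *: e i); split=> //; first exact: saturated_comb.
rewrite one_sum scaler_sumr.
by apply: eq_bigr => i _; rewrite scalerA Dr.
Qed.

Section LatticeOfSubspace.
Variables (d : nat) (W : set V).
Hypothesis WG : Grass d V W.

Definition lattice : set H := [set x | W (one x)].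

Let WS : submod_closed (mem W). Proof. by case: WG. Qed.

Let W0 : W 0. Proof. by case: WS => + _; rewrite inE. Qed.

Let WZD a u v : W u -> W v -> W (a *: u + v).
Proof. by case: WS => _ /(_ a u v); rewrite !inE; exact. Qed.

Let WZ a u : W u -> W (a *: u).
Proof. by move=> Wu; rewrite -[_ *: _]addr0; exact: WZD. Qed.

Let WD u v : W u -> W v -> W (u + v).
Proof. by move=> Wu Wv; rewrite -[u]scale1r; exact: WZD. Qed.

Lemma lattice_saturated : saturated lattice.
Proof.
split; rewrite /lattice /=.
- by rewrite raddf0.
- by move=> x y Wx Wy; rewrite raddfD; exact: WD.
- by move=> c x Wx; rewrite unit_tensorZ; exact: WZ.
- move=> c x c0; rewrite unit_tensorZ => /(@WZ (frac c)^-1).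
  by rewrite scalerA mulVf ?scale1r // tofrac_eq0.
Qed.

Lemma lattice_spanE : W = lattice_span lattice.
Proof.
apply/seteqP; split=> v.
  move=> Wv; have [D [x [D0 e]]] := tensor_denom v; exists D, x; split=> //.
  by rewrite /lattice /= -e; exact: WZ.
move=> [D [x [D0 + e]]]; rewrite /lattice /= -e => /(@WZ (frac D)^-1).
by rewrite scalerA mulVf ?scale1r // tofrac_eq0.
Qed.

(** Independence over the field with l elements of the classes modulo l H, put in terms of
    divisibility by [l]. *)
Definition indep_mod_l m (e : 'I_m -> H) := forall (c : 'I_m -> Zl) y,
  \sum_i c i *: e i = l%:R *: y -> forall i, exists c', c i = l%:R * c'.

Let l_neq0 : (l%:R : Zl) != 0.
Proof. by have := padic_natl_neq0 lP 1; rewrite expn1. Qed.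

(** The coefficients of a relation are divisible by [l]; H being torsion-free, the relation can be
    divided by [l] and the argument repeated, so that every power of [l] divides them. *)
Lemma indep_mod_l_indep m (e : 'I_m -> H) : indep_mod_l e ->
  forall c : 'I_m -> Zl, \sum_i c i *: e i = 0 -> forall i, c i = 0.
Proof.
move=> ind c c0 i; apply: padic_dvd_eq0 => n.
elim: n c c0 => [|n IHn] c c0; first by exists (c i); rewrite expn0 mul1r.
have /choice[c' cc'] : forall i, exists c', c i = l%:R * c'.
  by apply: (ind c 0); rewrite scaler0.
have [|b eb] := IHn c'.
  apply: (torsion_free l_neq0); rewrite scaler_sumr -[RHS]c0.
  by apply: eq_bigr => j _; rewrite scalerA -cc'.
by exists b; rewrite cc' eb mulrA -natrM -expnS.
Qed.

(** Finite generation of the lattice is not known beforehand. The dimension [d] bounds the size of a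
    family independent modulo [l], since such a family is independent over Z_l and then over Q_l; a
    family of maximal size generates modulo [l]. *)
Lemma max_indep_mod_l : exists m (e : 'I_m -> H),
  [/\ forall i, lattice (e i), indep_mod_l e & forall x, lattice x ->
      exists (c : 'I_m -> Zl) y, x = \sum_i c i *: e i + l%:R *: y].
Proof.
have [_ MD MZ MS] := lattice_saturated.
pose P m := `[< exists e : 'I_m -> H,
  (forall i, lattice (e i)) /\ indep_mod_l e >].
have exP : exists m, P m.
  exists 0%N; apply/asboolP; exists (fun=> 0); split=> [[]//|c y _ []//].
have boundP m : P m -> (m <= d)%N.
  move=> /asboolP[e [Me /indep_mod_l_indep/indep_unit_tensor ind]].
  case: WG => _ [b [_ eW]]; apply: lin_indep_leq (fun i => b i) _ ind => i.
  by have := Me i; rewrite /lattice /= eW => -[c _ <-]; exists c.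
case: (ex_maxnP exP boundP) => m /asboolP[e [Me ind]] maxm.
exists m, e; split=> // x Mx; apply: contrapT => nx.
suff /maxm : P m.+1 by rewrite ltnn.
apply/asboolP; exists (fun i => oapp e x (unlift ord0 i)); split.
  by move=> i; case: unliftP => [j|] _ /=; [exact: Me|exact: Mx].
move=> c y; rewrite big_ord_recl unlift_none /=.
under eq_bigr do rewrite liftK /=.
(* If the coefficient of [x] is a unit, [x] is a combination of the [e i] modulo [l], against [nx];
   otherwise its term moves into the multiple of [l] and [ind] applies to the others. *)
move=> ec; have [[b bc]|[b cb]] := padic_unit_or_dvd (c ord0).
  case: nx; exists (fun i => - (b * c (fintype.lift ord0 i))), (b *: y).
  rewrite -[LHS]scale1r -[X in X *: _ = _]bc.
  under eq_bigr do rewrite scaleNr -scalerA.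
  rewrite sumrN -scaler_sumr scalerA [l%:R * b]mulrC -(scalerA b l%:R) -ec.
  by rewrite scalerDr scalerA addrC addrK.
move=> i; have [j ->|->] := unliftP ord0 i; last by exists b.
apply: (ind (fun i => c (fintype.lift ord0 i)) (y - b *: x)).
by rewrite scalerBr scalerA -cb -ec addrAC subrr add0r.
Qed.

(** Nakayama's lemma by successive approximation: the remainder [y] lies in the lattice by
    saturation, so it can be expanded in turn, and the coefficients converge l-adically. The final
    remainder is divisible by every l^n and vanishes at each level of the completion. *)
Lemma lattice_gen m (e : 'I_m -> H) : (forall i, lattice (e i)) ->
  (forall x, lattice x ->
     exists (c : 'I_m -> Zl) y, x = \sum_i c i *: e i + l%:R *: y) ->
  forall x, lattice x -> exists c : 'I_m -> Zl, x = \sum_i c i *: e i.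
Proof.
have [_ MD MZ MS] := lattice_saturated.
move=> Me gen x0 Mx0.
have /choice[cy cyE] : forall x, exists cy : ('I_m -> Zl) * H, lattice x ->
    lattice cy.2 /\ x = \sum_i cy.1 i *: e i + l%:R *: cy.2.
  move=> x; have [Mx|nMx] := pselect (lattice x); last by exists (fun=> 0, 0).
  have [c [y e_x]] := gen x Mx; exists (c, y) => _; split=> //=.
  apply: (MS _ _ l_neq0); have -> : l%:R *: y = x + (-1) *: \sum_i c i *: e i.
    by rewrite e_x scaleN1r addrAC subrr add0r.
  apply: MD => //; apply: MZ; apply: saturated_comb => //.
  exact: lattice_saturated.
pose xs n := iter n (fun x => (cy x).2) x0.
have Mxs n : lattice (xs n) by elim: n => //= n /cyE[].
pose s n i : Zl := \sum_(k < n) (l ^ k)%:R * (cy (xs k)).1 i.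
have sE n : x0 = \sum_i s n i *: e i + (l ^ n)%:R *: xs n.
  elim: n => [|n IHn].
    by rewrite expn0 scale1r big1 ?add0r // => i _; rewrite /s big_ord0 scale0r.
  rewrite {1}IHn; have [_ {1}->] := cyE _ (Mxs n).
  rewrite scalerDr scalerA -natrM -expnSr addrA; congr (_ + _).
  rewrite scaler_sumr -big_split /=; apply: eq_bigr => i _.
  by rewrite scalerA -scalerDl /s big_ord_recr.
(* Successive partial sums differ by a multiple of l^n, so the residues of [s n i] at level [n]
   define the limit. *)
have sP i n : (s n i) n = (s n.+1 i n.+1 %% (l ^ n)%N)%Z.
  rewrite -padicP; apply/esym/padic_res_sub; rewrite {1}/s big_ord_recr.
  by rewrite -/(s n i) addrAC subrr add0r padic_res_mul_eq0.
pose c i : Zl := PadicInt lP (sP i).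
exists c; apply/eqP; rewrite -subr_eq0; apply/eqP/comp_ext => n.
have /choice[b bE] : forall i, exists b, s n i - c i = (l ^ n)%:R * b.
  by move=> i; apply: padic_dvd; exact: (iffRL (padic_res_sub (s n i) (c i) n)).
have -> : x0 - \sum_i c i *: e i = (\sum_i b i *: e i + xs n) *+ (l ^ n).
  rewrite {1}(sE n) addrAC -sumrB -scaler_nat scalerDr; congr (_ + _).
  rewrite scaler_sumr; apply: eq_bigr => i _.
  by rewrite -scalerBl bE scalerA.
by rewrite comp_res_mulln.
Qed.

Lemma lattice_zbasis : exists e : 'I_d -> H, zbasis lattice e.
Proof.
have [m [e [Me ind /(lattice_gen Me) gen]]] := max_indep_mod_l.
have indl := indep_mod_l_indep ind.
case: (WG) => _ [b [indb eW]].
have Wb i : W (b i).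
  rewrite eW; exists (fun j => (j == i)%:R) => //.
  rewrite (bigD1 i) //= eqxx scale1r big1 ?addr0 // => j /negPf ->.
  by rewrite scale0r.
have led : (d <= m)%N.
  apply: lin_indep_leq (fun i => one (e i)) _ indb => i.
  have := Wb i; rewrite lattice_spanE => -[D [x [D0 /gen[c ->] ev]]].
  exists (fun i => (frac D)^-1 * frac (c i)).
  under eq_bigr do rewrite -scalerA.
  rewrite -scaler_sumr -one_sum -ev scalerA mulVf ?scale1r //.
  by rewrite tofrac_eq0.
have lem : (m <= d)%N.
  apply: (@lin_indep_leq _ _ _ _ _ b _ (indep_unit_tensor indl)) => i.
  by have := Me i; rewrite /lattice /= eW => -[c _ <-]; exists c.
have emd : m = d by apply/eqP; rewrite eqn_leq lem.
by move: e Me ind gen indl {led lem}; rewrite emd => e Me _ gen indl; exists e.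
Qed.

End LatticeOfSubspace.
End Lattices.

(** * Roots of unity and Galois groups *)

Section MulGroupMaps.

Lemma mgD (F : fieldType) (x y : mulgroup F) : val (x + y) = val x * val y.
Proof. by []. Qed.

Lemma mgMn (F : fieldType) (x : mulgroup F) n : val (x *+ n) = val x ^+ n.
Proof. by elim: n => [|n IHn]; rewrite ?mulr0n // mulrS exprS mgD IHn. Qed.

Definition mg (F : fieldType) (x : F) (x0 : x != 0) : mulgroup F := exist _ x x0.

Variables (F L : fieldType) (f : {rmorphism F -> L}).

Fact mg_map_neq0 (x : mulgroup F) : f (val x) != 0.
Proof. by rewrite fmorph_eq0 (valP x). Qed.

Definition mg_map (x : mulgroup F) : mulgroup L := mg (mg_map_neq0 x).

Fact mg_map_is_additive : zmod_morphism mg_map.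
Proof. by move=> x y; apply: val_inj; rewrite /= rmorphM fmorphV. Qed.

HB.instance Definition _ :=
  GRing.isZmodMorphism.Build (mulgroup F) (mulgroup L) mg_map mg_map_is_additive.

Lemma mg_map_inj : injective mg_map.
Proof. by move=> x y /(congr1 val)/fmorph_inj/val_inj. Qed.

End MulGroupMaps.

Section RootsOfUnity.
Variables (l : nat) (lP : prime l) (F : fieldType).

Definition zeta_system (z : nat -> mulgroup F) :=
  (forall k, z k.+1 *+ l = z k) /\
  (forall k (j : int), z k *~ j = 0 <-> ((l ^ k)%N %| j)%Z).

Lemma zeta_kummer_system (K : fieldType) (f : {rmorphism F -> K}) z :
  zeta_system z -> kummer_system l (mg_map f) z.
Proof.
move=> [zS z0]; split=> //; first exact: mg_map_inj.
move=> k b bk; pose x := val (mg_map f (z k)).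
have xE m : (x ^+ m == 1) = (l ^ k %| m)%N.
  have -> : (x ^+ m == 1) = (z k *+ m == 0).
    rewrite -(inj_eq (@mg_map_inj _ _ f)) raddf0 raddfMn -(inj_eq val_inj).
    by rewrite mgMn.
  rewrite pmulrn; apply/eqP/idP => [/z0|dv]; first by rewrite dvdzE.
  by apply/z0; rewrite dvdzE.
have xprim : (l ^ k).-primitive_root x.
  rewrite /primitive_root_of_unity expn_gt0 prime_gt0 //=.
  apply/forallP => i; rewrite unity_rootE xE; apply/eqP.
  by apply/idP/eqP => [/(dvdn_leq (ltn0Sn _)) le|-> //];
    apply/eqP; rewrite eqn_leq ltn_ord le.
have : val b ^+ (l ^ k) = 1 by rewrite -mgMn bk.
move=> /(prim_rootP xprim)[i e]; exists i; apply: val_inj.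
by rewrite e -pmulrn raddfMn /= mgMn.
Qed.

Lemma separable_XnsubC (K : fieldType) n (c : K) :
  (n%:R : K) != 0 -> c != 0 -> separable_poly ('X^n - c%:P).
Proof.
move=> n0 c0; have n_gt0 : (0 < n)%N.
  by rewrite lt0n; apply: contra n0 => /eqP ->.
rewrite separable_poly.unlock derivB derivXn derivC subr0 -scaler_nat coprimepZr //.
apply: coprimep_expr; rewrite coprimepX rootE !hornerE expr0n eqn0Ngt n_gt0 /= sub0r.
by rewrite oppr_eq0.
Qed.

Variables (L : fieldType) (iota : {rmorphism F -> L}).
Hypothesis charF : l \notin [pchar F].
Hypothesis sepF : separable_closure iota.
Hypothesis muF : mu_linfty L l `<=` range iota.

Lemma l_neq0 : (l%:R : L) != 0.
Proof.
by rewrite -(rmorph_nat iota) fmorph_eq0; apply: contra charF => l0; rewrite inE lP.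
Qed.

Lemma mulgroup_l_divisible (c : mulgroup L) : exists d, d *+ l = c.
Proof.
have sep := separable_XnsubC l_neq0 (valP c).
have [|x] := sepF.2 _ sep.
  by rewrite size_XnsubC ?prime_gt0 // -[1%N]/(0.+1) eqSS -lt0n prime_gt0.
rewrite rootE !hornerE subr_eq0 => /eqP xl.
have x0 : x != 0.
  apply: contraTneq (valP c) => x0; rewrite /= -xl x0 expr0n.
  by rewrite eqn0Ngt prime_gt0 // eqxx.
by exists (mg x0); apply: val_inj; rewrite mgMn.
Qed.

(** A root of the cofactor [p] of ['X - 1] in ['X^l - 1]; it is not 1 because [p] takes the value
    [l] at 1, which is nonzero in L. *)
Lemma zeta1_exists : exists2 w : mulgroup L, w *+ l = 0 & w <> 0.
Proof.
pose p : {poly L} := \sum_(i < l) 'X^i.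
have pE : 'X^l - 1 = ('X - 1) * p.
  by rewrite subrX1.
have sep : separable_poly ('X^l - 1 : {poly L}).
  exact: separable_XnsubC l_neq0 (oner_neq0 _).
have szp : size p = l.
  have := size_XnsubC (1 : L) (prime_gt0 lP); rewrite pE.
  rewrite mulrC size_Mmonic ?monicXsubC //; last first.
    by apply/eqP => p0; have := separable_poly_neq0 sep; rewrite pE p0 mulr0 eqxx.
  by rewrite size_XsubC addn2 => -[].
have [||x px] := sepF.2 p.
- by apply: dvdp_separable sep; rewrite pE dvdp_mull.
- by rewrite szp; case: (l) (prime_gt1 lP) => [|[]].
have xl : x ^+ l = 1.
  by apply/eqP; rewrite -subr_eq0; have := congr1 (horner^~ x) pE;
    rewrite hornerM (eqP px) mulr0 !hornerE => ->.
have x1 : x <> 1.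
  move=> x1; move: px; rewrite x1 rootE horner_sum.
  under eq_bigr do rewrite hornerXn expr1n.
  by rewrite sumr_const card_ord (negPf l_neq0).
have x0 : x != 0.
  apply: contra_eq_neq xl => ->.
  by rewrite expr0n eqn0Ngt prime_gt0 // eq_sym oner_neq0.
exists (mg x0); first by apply: val_inj; rewrite mgMn.
by move=> /(congr1 val).
Qed.

Lemma zeta_system_exists : exists z, zeta_system z.
Proof.
have [w wl w0] := zeta1_exists.
have /choice[g gl] := mulgroup_l_divisible.
(* [y 0] is the neutral element and [y 1 = w] has exact order [l]; the later terms are successive
   l-th roots, taken in L and brought down to F by [muF]. *)
pose y n := if n is n'.+1 then iter n' g w else 0.
have yS k : y k.+1 *+ l = y k by case: k => [|k] /=; rewrite ?wl ?gl.
have yk k : y k *+ (l ^ k) = 0.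
  by elim: k => [|k IHk]; rewrite ?mulr1n // expnS mulrnA yS.
have y1 k n : y (n + k)%N *+ (l ^ k) = y n.
  elim: k => [|k IHk]; first by rewrite addn0 mulr1n.
  by rewrite addnS expnS mulrnA yS.
have yE k (j : int) : y k *~ j = 0 <-> ((l ^ k)%N %| j)%Z.
  split=> [|/dvdzP[q ->]]; last by rewrite mulrC mulrzA -pmulrn yk mul0rz.
  elim: k j => [|k IHk] j yj; first by rewrite expn0 dvd1z.
  have wj : w *~ j = 0.
    rewrite -[w]/(y 1%N) -(y1 k 1%N) add1n pmulrn -mulrzA mulrC mulrzA yj.
    by rewrite mul0rz.
  have : (l%:Z %| j)%Z.
    apply: contraT => nl; have /coprimezP[[u v] /= e] : coprimez l j.
      by rewrite coprimezE absz_nat prime_coprime // -dvdzE.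
    case: w0; rewrite -[w]mulr1z -e mulrzDr mulrC [v * j]mulrC !mulrzA wj.
    by rewrite -pmulrn wl !mul0rz addr0.
  move=> /dvdzP[q jq]; rewrite jq expnSr PoszM dvdz_mul //.
  by apply: IHk; rewrite -yS pmulrn -mulrzA mulrC -jq.
have /choice[z zE] : forall k, exists a, mg_map iota a = y k.
  move=> k; have [a _ ak] : range iota (val (y k)).
    by apply: muF; exists k; rewrite -mgMn yk.
  have a0 : a != 0 by rewrite -(fmorph_eq0 iota) ak (valP (y k)).
  by exists (mg a0); apply: val_inj.
exists z; split=> [k|k j].
  by apply: (@mg_map_inj _ _ iota); rewrite raddfMn /= !zE yS.
rewrite -yE -zE -raddfMz -(raddf0 (mg_map iota)).
by split=> [->//|/mg_map_inj].
Qed.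

Lemma separable_closed_split (p : {poly L}) : separable_poly p ->
  exists rs, p %= \prod_(x <- rs) ('X - x%:P).
Proof.
have [n] := ubnP (size p); elim: n p => // n IHn p le_p sep.
have [sz1|sz1] := eqVneq (size p) 1%N.
  by exists [::]; rewrite big_nil -size_poly_eq1 sz1.
have [x /factor_theorem[q e]] := sepF.2 p sep sz1.
have q0 : q != 0.
  by apply: contra_neq (separable_poly_neq0 sep) => q0; rewrite e q0 mul0r.
have [||rs qrs] := IHn q.
- move: le_p; rewrite e size_Mmonic ?monicXsubC // size_XsubC.
  by rewrite addn2.
- by apply: dvdp_separable sep; rewrite e dvdp_mulr.
by exists (x :: rs); rewrite big_cons e mulrC eqp_mul2l ?polyXsubC_eq0.
Qed.

Lemma separable_closure_splits x : splits_at iota x.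
Proof.
have [p [irr sep px]] := sepF.1 x.
have := separable_map iota p; rewrite sep => /separable_closed_split[rs prs].
by exists p; [exact: separable_poly_neq0|split=> //; exists rs].
Qed.

End RootsOfUnity.

Section GaloisExtensions.
Variables (F L : fieldType) (iota : {rmorphism F -> L}).
Implicit Types K : subextension iota.

Section InSubfield.
Variable K : subextension iota.

Fact in_subfield_is_zmod_morphism : zmod_morphism (in_subfield K).
Proof. by move=> x y; apply: val_inj; rewrite /= rmorphB. Qed.

Fact in_subfield_is_monoid_morphism : monoid_morphism (in_subfield K).
Proof.
by split=> [|x y]; apply: val_inj; rewrite /= ?rmorph1 // rmorphM.
Qed.

HB.instance Definition _ := GRing.isZmodMorphism.Build F (subfield K)
  (in_subfield K) in_subfield_is_zmod_morphism.
HB.instance Definition _ := GRing.isMonoidMorphism.Build F (subfield K)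
  (in_subfield K) in_subfield_is_monoid_morphism.

Definition subfield_val (x : subfield K) : L := val x.

Fact subfield_val_is_zmod_morphism : zmod_morphism subfield_val.
Proof. by []. Qed.

Fact subfield_val_is_monoid_morphism : monoid_morphism subfield_val.
Proof. by []. Qed.

HB.instance Definition _ := GRing.isZmodMorphism.Build (subfield K) L
  subfield_val subfield_val_is_zmod_morphism.
HB.instance Definition _ := GRing.isMonoidMorphism.Build (subfield K) L
  subfield_val subfield_val_is_monoid_morphism.

Fact gal_is_zmod_morphism (s : gal K) : zmod_morphism s.
Proof.
by move=> x y; apply: (addIr (s y)); rewrite -galD !subrK.
Qed.

Fact gal_is_monoid_morphism (s : gal K) : monoid_morphism s.
Proof.
split; last exact: galM.
by rewrite -(rmorph1 (in_subfield K)) gal_base.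
Qed.

HB.instance Definition _ s := GRing.isZmodMorphism.Build (subfield K)
  (subfield K) (gal_fun s) (gal_is_zmod_morphism s).
HB.instance Definition _ s := GRing.isMonoidMorphism.Build (subfield K)
  (subfield K) (gal_fun s) (gal_is_monoid_morphism s).

Lemma galois_splits : galois_ext K -> forall x : subfield K,
  exists p : {poly F}, [/\ irreducible_poly p, separable_poly p,
    root (map_poly (in_subfield K) p) x &
    exists rs, map_poly (in_subfield K) p %= \prod_(z <- rs) ('X - z%:P)].
Proof.
move=> [sepK normK] x; have [p [irr sep px]] := sepK _ (valP x).
exists p; have mapE : map_poly subfield_val (map_poly (in_subfield K) p) =
    map_poly iota p by rewrite -map_poly_comp.
split=> //; first by rewrite -(fmorph_root subfield_val) mapE.
have [|rs rsK prs] := normK p irr; first by exists (val x); [exact: valP|].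
have [rs' ers] : exists rs' : seq (subfield K), rs = map subfield_val rs'.
  elim: rs rsK {prs} => [|z rs IHrs] zrsK; first by exists [::].
  have [|rs' ->] := IHrs; first by
    move=> w wrs; apply: zrsK; rewrite in_cons wrs orbT.
  have zK : z \in subext K by apply: zrsK; rewrite mem_head.
  by exists ((exist _ z zK : subfield K) :: rs').
exists rs'; rewrite -(eqp_map subfield_val) mapE (eqp_trans prs) //.
rewrite ers rmorph_prod big_map /=.
under [X in _ %= X]eq_bigr do rewrite rmorphB /= map_polyX map_polyC.
exact: eqpxx.
Qed.

End InSubfield.

(** The minimal polynomials over F, read over [K0], remain separable and split in [K], so that
    [field_aut_moves] applies with [K0] as base field. *)
Lemma gal_moves_over (K0 K : subextension iota) (z : subfield K) :
  {subset K0 <= K} -> galois_ext K -> val z \notin K0 ->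
  exists2 s : gal K, forall y : subfield K, val y \in K0 -> s y = y & s z <> z.
Proof.
move=> sub galK zK0.
pose incl (x : subfield K0) : subfield K := exist _ (val x) (sub _ (valP x)).
have inclB : zmod_morphism incl by move=> x y; apply: val_inj.
have inclM : monoid_morphism incl by split=> [|x y]; apply: val_inj.
pose f : {rmorphism subfield K0 -> subfield K} :=
  HB.pack_for {rmorphism subfield K0 -> subfield K} incl
    (GRing.isZmodMorphism.Build _ _ incl inclB)
    (GRing.isMonoidMorphism.Build _ _ incl inclM).
have fE p : map_poly f (map_poly (in_subfield K0) p) =
    map_poly (in_subfield K) p.
  rewrite -map_poly_comp; apply: eq_map_poly => a; exact: val_inj.
have splf x : splits_at f x.
  have [p [irr sep px prs]] := galois_splits galK x.
  exists (map_poly (in_subfield K0) p); last by rewrite fE.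
  by rewrite map_poly_eq0 separable_poly_neq0.
have [p [irr sep pz _]] := galois_splits galK z.
have [|||s [sD sM sf sb] sz] := @field_aut_moves _ _ f z
  (map_poly (in_subfield K0) p) splf; rewrite ?separable_map ?fE //.
  by case=> x _ e; case/negP: zK0; rewrite -e; exact: (valP x).
have s1 a : s (in_subfield K a) = in_subfield K a.
  have -> : in_subfield K a = f (in_subfield K0 a) by exact: val_inj.
  exact: sf.
exists (Gal sD sM s1 sb) => //= y yK0.
have -> : y = f (exist _ (val y) yK0) by exact: val_inj.
exact: sf.
Qed.

Fact base_divring_closed : divring_closed (fun x : L => `[< range iota x >]).
Proof.
split=> [|x y|x y]; rewrite !unfold_in.
- by apply/asboolP; exists 1; rewrite ?rmorph1.
- move=> /asboolP[a _ <-] /asboolP[b _ <-]; apply/asboolP.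
  by exists (a - b); rewrite ?rmorphB.
- move=> /asboolP[a _ <-] /asboolP[b _ <-]; apply/asboolP.
  by exists (a / b); rewrite ?fmorph_div.
Qed.

Fact base_subset x : iota x \in (fun x : L => `[< range iota x >]).
Proof. by apply/asboolP; exists x. Qed.

Definition base_subext : subextension iota :=
  SubExtension base_divring_closed base_subset.

Lemma gal_fixed K (z : subfield K) : galois_ext K ->
  (forall s : gal K, s z = z) -> exists a, z = in_subfield K a.
Proof.
move=> galK fix_z; have [/asboolP[a _ e]|nz] := boolP (val z \in base_subext).
  by exists a; apply: val_inj.
have [|s _ []//] := @gal_moves_over base_subext K z _ galK nz.
by move=> _ /asboolP[a _ <-]; exact: subext_base.
Qed.

End GaloisExtensions.

(** * Z_l^d-extensions *)

(** The relation is assumed on [P] only, and the maps are told apart by elements of [P]: this suits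
    automorphisms considered at a finite level. The relation is shortened by comparing its value at
    [c0 * c] with [tau t0 c0] times its value at [c]. *)
Lemma dedekind_independence (T : eqType) (E : fieldType) (tau : T -> E -> E)
    (P : set E) (s : seq T) (a : T -> E) :
  P 1 -> (forall x y, P x -> P y -> P (x * y)) ->
  (forall t, tau t 1 = 1) -> (forall t, {morph tau t : x y / x * y}) ->
  uniq s ->
  {in s &, forall t t', t != t' -> exists2 c, P c & tau t c != tau t' c} ->
  (forall c, P c -> \sum_(t <- s) a t * tau t c = 0) ->
  {in s, forall t, a t = 0}.
Proof.
move=> P1 PM tau1 tauM; elim: s a => [//|t0 s IHs] a /= /andP[t0s us] dist sum0.
have as0 : {in s, forall t, a t = 0}.
  move=> t ts; have [|||c0 Pc0 ne] := dist t t0; rewrite ?in_cons ?ts ?eqxx ?orbT //.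
    by apply: contraNneq t0s => <-.
  suff /(_ t ts)/eqP : {in s, forall t, a t * (tau t c0 - tau t0 c0) = 0}.
    by rewrite mulf_eq0 subr_eq0 (negPf ne) orbF => /eqP.
  apply: IHs => // [u v us' vs|c Pc].
    by apply: dist; rewrite in_cons ?us' ?vs orbT.
  have e1 := sum0 _ (PM _ _ Pc0 Pc); have := sum0 _ Pc.
  move=> /(congr1 ( *%R (tau t0 c0))); rewrite mulr0 -[in RHS]e1 => /esym/eqP.
  rewrite -subr_eq0 mulr_sumr -sumrB big_cons tauM mulrCA subrr add0r.
  move=> /eqP e2; rewrite -[RHS]e2; apply: eq_bigr => u _; rewrite tauM.
  by rewrite mulrBr mulrBl mulrA [tau t0 c0 * _]mulrCA -!mulrA.
move=> t; rewrite in_cons => /predU1P[->|/as0 //].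
have := sum0 1 P1; rewrite big_cons tau1 mulr1 big_seq big1 ?addr0 //.
by move=> u /as0 ->; rewrite mul0r.
Qed.

(** * Hilbert 90 for characters of finite level *)

Section HilbertNinety.
Variables (F L : fieldType) (iota : {rmorphism F -> L}) (K : subextension iota).
Implicit Types s t : gal K.

(** One automorphism is kept for each restriction to [e]; these representatives stand for the finite
    quotient of the group that acts on F(e). *)
Lemma restriction_reps (e : seq (subfield K)) (S : seq (gal K)) :
  exists S' : seq (gal K), [/\ uniq S',
    {in S, forall s, exists2 s', s' \in S' & {in e, s =1 s'}}
  & {in S' &, forall s s', {in e, s =1 s'} -> s = s'}].
Proof.
elim: S => [|s S [S' [uS' cov inj]]]; first by exists [::].
have [[s' s'S ss']|ns] := pselect (exists2 s', s' \in S' & {in e, s =1 s'}).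
  exists S'; split=> // t; rewrite in_cons => /predU1P[->|/cov//].
  by exists s'.
exists (s :: S'); split=> [|t|t t'].
- by rewrite /= uS' andbT; apply/negP => sS'; case: ns; exists s.
- rewrite in_cons => /predU1P[->|/cov[t' t'S tt']].
    by exists s; rewrite ?mem_head.
  by exists t'; rewrite ?in_cons ?t'S ?orbT.
- rewrite !in_cons => /predU1P[->|tS] /predU1P[->|t'S] // tt'.
  + by case: ns; exists t'.
  + by case: ns; exists t => // x xe; rewrite tt'.
  + exact: inj.
Qed.

(** The solution is the resolvent, the sum of [(chi t)^-1 * t c] over representatives of the
    restrictions to [e]. Dedekind's independence provides a [c] for which it is nonzero. *)
Lemma hilbert90 (e : seq (subfield K)) (S : seq (gal K))
    (chi : gal K -> subfield K) :
  (forall t, exists2 s, s \in S & {in e, t =1 s}) ->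
  (forall s t, chi (s * t)%g = chi s * chi t) ->
  (forall s t, s (chi t) = chi t) -> (forall t, chi t != 0) ->
  (forall t, {in e, t =1 id} -> chi t = 1) ->
  exists2 b, b != 0 & forall s, s b = chi s * b.
Proof.
move=> covS chiM chi_fix chi0 chi1.
have [S' [uS' covS' injS']] := restriction_reps e S.
have {covS} {}covS' t : exists2 s, s \in S' & {in e, t =1 s}.
  have [s /covS'[s' s'S ss'] ts] := covS t.
  by exists s' => // x xe; rewrite ts ?ss'.
(* The fixed field of the automorphisms that are trivial on [e]; on it an automorphism depends only
   on its restriction to [e]. *)
pose P : set (subfield K) := [set c | forall t, {in e, t =1 id} -> t c = c].
have Pe c : c \in e -> P c by move=> ce t; exact.
have eqP1 s t c : {in e, s =1 t} -> P c -> s c = t c.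
  move=> st Pc; apply: (can_inj (gal_invKV t)).
  rewrite gal_invK -[LHS]/((t^-1 * s)%g c); apply: Pc => x xe.
  by rewrite -[LHS]/(gal_inv_fun t (s x)) st // gal_invK.
have eq_chi s t : {in e, s =1 t} -> chi s = chi t.
  move=> st; have -> : s = (t * (t^-1 * s))%g by rewrite mulVKg.
  rewrite chiM (chi1 (t^-1 * s)%g) ?mulr1 // => x xe.
  by rewrite -[LHS]/(gal_inv_fun t (s x)) st // gal_invK.
have [c Pc b0] : exists2 c, P c & \sum_(t <- S') (chi t)^-1 * t c != 0.
  apply: contrapT => nc; have [s sS' _] := covS' 1%g.
  suff /(_ s sS')/eqP : {in S', forall t, (chi t)^-1 = 0}.
    by rewrite invr_eq0 (negPf (chi0 s)).
  apply: (@dedekind_independence _ _ (fun t => t : subfield K -> subfield K) P).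
  - by move=> t _; rewrite rmorph1.
  - by move=> x y Px Py t te; rewrite rmorphM /= Px ?Py.
  - by move=> t; rewrite rmorph1.
  - by move=> t x y; rewrite galM.
  - exact: uS'.
  - move=> t t' tS t'S ne; apply: contrapT => nex; case/eqP: ne.
    apply: injS' => // x xe; apply/eqP; apply: contraT => ne.
    by case: nex; exists x => //; exact: Pe.
  - move=> c Pc; apply/eqP; apply: contraT => ne.
    by case: nc; exists c.
exists (\sum_(t <- S') (chi t)^-1 * t c) => // s.
(* Left multiplication by [s] permutes the representatives up to agreement on [e], and neither [chi]
   nor the action on [P] sees the difference. *)
have /choice[pi piE] : forall t, exists t', t' \in S' /\ {in e, (s * t)%g =1 t'}.
  by move=> t; have [t' ? ?] := covS' (s * t)%g; exists t'.
have perm_pi : perm_eq (map pi S') S'.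
  have um : uniq (map pi S').
    rewrite map_inj_in_uniq // => t t' tS t'S ett'; apply: injS' => // x xe.
    apply: (can_inj (gal_invK s)); rewrite -[LHS]/((s * t)%g x).
    by rewrite (piE t).2 // ett' -(piE t').2.
  apply: uniq_perm => //; apply: (uniq_min_size um _ _).2.
    by move=> _ /mapP[t _ ->]; exact: (piE t).1.
  by rewrite size_map.
rewrite -[in RHS](perm_big _ perm_pi) big_map mulr_sumr rmorph_sum.
apply: eq_bigr => t _; rewrite rmorphM fmorphV /= chi_fix.
rewrite -[s (t c)]/((s * t)%g c) (eqP1 _ _ _ (piE t).2 Pc) mulrA.
congr (_ * _); rewrite -(eq_chi _ _ (piE t).2) chiM invfM mulrA.
by rewrite divff ?mul1r.
Qed.

End HilbertNinety.

(** Additivity gives linearity over the integers; modulo l^k the coordinates of [c] may be replaced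
    by integers close to them. *)
Lemma padic_linear (l : nat) (lP : prime l) d
    (g : 'rV[padic_int lP]_d -> padic_int lP) :
  {morph g : x y / x - y} ->
  (forall k, exists N, forall c : 'rV[padic_int lP]_d,
    (forall i, c 0 i N = 0) -> g c k = 0) ->
  forall c, g c = \sum_i c 0 i * g (delta_mx 0 i).
Proof.
move=> gB gcont c; apply: padic_ext => k; apply/padic_res_sub.
(* Precision [N] makes [g (c - c')] vanish modulo l^k, and precision [k] does the same for the
   coefficients. *)
have [N gN] := gcont k; pose N' := (N + k)%N.
pose n i : int := c 0 i N'.
have cn i m : (m <= N')%N -> (c 0 i - (n i)%:~R) m = 0.
  move=> mN; rewrite -[RHS](padic_res0 lP m); apply: (res_leq mN).
  rewrite padic_res0; apply/padic_res_sub.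
  by rewrite padic_res_int padic_res_mod.
have /choice[b bE] : forall i, exists b, c 0 i - (n i)%:~R = (l ^ k)%:R * b.
  by move=> i; apply: padic_dvd; apply: cn; rewrite leq_addl.
pose gA : {additive 'rV[padic_int lP]_d -> padic_int lP} :=
  HB.pack_for {additive 'rV[padic_int lP]_d -> padic_int lP} g
    (GRing.isZmodMorphism.Build _ _ g gB).
pose c' := \sum_i (delta_mx 0 i : 'rV[padic_int lP]_d) *~ n i.
have c'E i : c' 0 i = (n i)%:~R.
  rewrite summxE (bigD1 i) //= big1 ?addr0 => [|j ji].
    by rewrite -scaler_int !mxE !eqxx mulr1.
  by rewrite -scaler_int !mxE eq_sym (negPf ji) andbF mulr0.
have gc' : g c' = \sum_i (n i)%:~R * g (delta_mx 0 i).
  rewrite -[g]/(gA : _ -> _) raddf_sum; apply: eq_bigr => i _.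
  by rewrite raddfMz mulrzl.
have -> : g c - \sum_i c 0 i * g (delta_mx 0 i) =
    g (c - c') - (l ^ k)%:R * \sum_i b i * g (delta_mx 0 i).
  have -> : (l ^ k)%:R * (\sum_i b i * g (delta_mx 0 i)) =
      \sum_i c 0 i * g (delta_mx 0 i) - g c'.
    rewrite gc' -sumrB mulr_sumr; apply: eq_bigr => i _.
    by rewrite mulrA -bE mulrBl.
  by rewrite gB opprB addrA subrK.
apply/padic_res_sub; rewrite padic_res_mul_eq0; apply: gN => i.
by rewrite !mxE c'E; apply: cn; rewrite leq_addr.
Qed.

Section ZldExtensions.
Variables (l : nat) (lP : prime l) (F L : fieldType) (iota : {rmorphism F -> L}).
Variables (K : subextension iota) (z : nat -> mulgroup F).
Hypothesis zz : zeta_system l z.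
Local Notation Zl := (padic_int lP).
Local Notation H := (completion (mulgroup F) lP).
Local Notation io := (mg_map (in_subfield K)).
Implicit Types (s t : gal K) (x y : H).

Let zK : kummer_system l io z. Proof. exact: zeta_kummer_system. Qed.

Lemma kroot_subfield x k (b : mulgroup (subfield K)) :
  kroot io x k b <-> kroot (mg_map iota) x k (mg_map (@subfield_val _ _ _ K) b).
Proof.
split=> -[a ba ax]; exists a => //.
  by rewrite -raddfMn ba; apply: val_inj.
apply: (@mg_map_inj _ _ (@subfield_val _ _ _ K)).
by rewrite raddfMn /= ba; apply: val_inj.
Qed.

Definition rooted_in : set H := [set x | rooted io x].

Lemma rooted_in_saturated : saturated rooted_in.
Proof.
split; rewrite /rooted_in /=.
- exact: rooted0.
- by move=> x y; exact: rooted_add.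
- by move=> c x; exact: rooted_scale.
- move=> c x c0; have [n [u [v [vu ->]]]] := padic_factor c0.
  rewrite -scalerA scaler_nat => /(rooted_div zK)/(rooted_scale v).
  by rewrite scalerA vu scale1r.
Qed.

Lemma mg_map_gal_io s a : mg_map s (io a) = io a.
Proof. by apply: val_inj; rewrite /= gal_base. Qed.

Lemma mg_map_gal_fixed (b : mulgroup (subfield K)) : galois_ext K ->
  (forall s, mg_map s b = b) -> exists a, b = io a.
Proof.
move=> galK fb; have [|a e] := gal_fixed galK (z := val b).
  by move=> s; rewrite -[LHS]/(val (mg_map s b)) fb.
have a0 : a != 0 by have := valP b; rewrite /= e fmorph_eq0.
by exists (mg a0); apply: val_inj.
Qed.

(** [b n *+ (l ^ n)] is fixed by the group, so it comes from some [a n] in F^*; [b n] and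
    [b n.+1 *+ l] have the same character, so they differ by an element of F^*, which makes the
    classes of the [a n] compatible. *)
Lemma kchar_element (u : gal K -> Zl) : galois_ext K ->
  (forall n, exists b, forall s, mg_map s b = b + io (z n *~ u s n)) ->
  exists2 x, rooted_in x & forall s, kchar io z (mg_map s) x (u s).
Proof.
move=> galK /choice[b bE].
have [zS _] := zz.
have /choice[a aE] : forall n, exists a, b n *+ (l ^ n) = io a.
  move=> n; apply: mg_map_gal_fixed => // s.
  by rewrite raddfMn /= bE mulrnDl -raddfMn (zeta_torsion zK) raddf0 addr0.
have step n : exists c, b n = b n.+1 *+ l + io c.
  have [|c e] := @mg_map_gal_fixed (b n - b n.+1 *+ l) galK.
    move=> s; rewrite raddfB raddfMn /= !bE mulrnDl -raddfMn.
    have -> : (z n.+1 *~ u s n.+1) *+ l = z n *~ u s n.+1.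
      by rewrite -(zS n) !pmulrn -!mulrzA [in LHS]mulrC.
    have -> : z n *~ u s n.+1 = z n *~ u s n.
      by rewrite -(zeta_mod zK) -padicP.
    by rewrite opprD addrACA subrr addr0.
  by exists c; rewrite -e addrC subrK.
have xP n : \pi_(lquot l (mulgroup F) n)%qT (a n) =
    lproj (\pi_(lquot l (mulgroup F) n.+1)%qT (a n.+1)).
  rewrite lproj_pi; apply/lquot_eq; have [c e] := step n; exists c.
  apply: (@mg_map_inj _ _ (in_subfield K)).
  by rewrite raddfD raddfMn /= -!aE e mulrnDl -mulrnA -expnS.
have xb n : kroot io (Completion lP xP) n (b n) by exists (a n).
exists (Completion lP xP); first by move=> n; exists (b n); exact: xb.
move=> s; apply: (kcharP zK (mg_map_gal_io s)) => n.
by exists (b n); [exact: xb|exact: bE].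
Qed.

Lemma nbhs_mxP d (c : 'rV[Zl]_d) (A : set 'rV[Zl]_d) :
  nbhs c A ->
  exists N, forall c' : 'rV[Zl]_d, (forall i, c' 0 i N = c 0 i N) -> A c'.
Proof.
move=> [P nP sub].
have /choice[n nE] : forall i, exists n, forall b : Zl, b n = c 0 i n -> P 0 i b.
  by move=> i; exact: nP.
exists (\max_i n i) => c' cc'; apply: sub => i j; rewrite ord1.
by apply: nE; apply: res_leq (cc' j); exact: leq_bigmax.
Qed.

Lemma mxP_nbhs d (c : 'rV[Zl]_d) (A : set 'rV[Zl]_d) N :
  (forall c' : 'rV[Zl]_d, (forall i, c' 0 i N = c 0 i N) -> A c') -> nbhs c A.
Proof.
move=> sub; exists (fun i j => [set b : Zl | b N = c i j N]).
  by move=> i j; exists N.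
by move=> c' cc'; apply: sub => i; exact: cc'.
Qed.

Variable d : nat.
Variables (phi : gal K -> 'rV[Zl]_d) (psi : 'rV[Zl]_d -> gal K).
Hypotheses (galK : galois_ext K)
  (phiM : {morph phi : s t / (s * t)%g >-> s + t})
  (phiK : cancel phi psi) (psiK : cancel psi phi)
  (phi_cont : continuous phi) (psi_cont : continuous psi).

Let phi1 : phi 1%g = 0.
Proof. by apply: (addrI (phi 1%g)); rewrite -phiM mulg1 addr0. Qed.

Let psiD c c' : psi (c + c') = (psi c * psi c')%g.
Proof. by apply: (can_inj phiK); rewrite psiK phiM !psiK. Qed.

Let psi0 : psi 0 = 1%g. Proof. by rewrite -phi1 phiK. Qed.

Lemma psi_fixes (e : seq (subfield K)) : exists N, forall c : 'rV[Zl]_d,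
  (forall i, c 0 i N = 0) -> {in e, psi c =1 id}.
Proof.
have [|N NP] := @nbhs_mxP d 0 [set c | {in e, psi c =1 id}].
  have psi_nbhs A : nbhs (psi 0) A -> nbhs (0 : 'rV[Zl]_d) (psi @^-1` A).
    exact: psi_cont.
  by have := psi_nbhs [set t : gal K | {in e, t =1 id}]; rewrite psi0; apply; exists e.
by exists N => c c0; apply: NP => i; rewrite mxE padic_res0.
Qed.

Lemma phi_vanishes n : exists e : seq (subfield K), forall s,
  {in e, s =1 id} -> forall i, phi s 0 i n = 0.
Proof.
have phi_nbhs A : nbhs (phi 1%g) A -> nbhs (1%g : gal K) (phi @^-1` A).
  exact: phi_cont.
have [|e eP] := phi_nbhs [set c : 'rV[Zl]_d | forall i, c 0 i n = 0].
  rewrite phi1; apply: (@mxP_nbhs d 0 _ n) => c c0 i.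
  by rewrite c0 mxE padic_res0.
by exists e => s se; apply: eP.
Qed.

(** Z_l^d modulo l^N is finite and, by [psi_fixes], a row that vanishes modulo l^N acts trivially on
    [e]. *)
Lemma finite_cover (e : seq (subfield K)) : exists S : seq (gal K),
  forall t, exists2 s, s \in S & {in e, t =1 s}.
Proof.
have [N NP] := psi_fixes e.
(* The residues are below l^N; the bound [(l ^ N).+1] only serves [inord], which needs a
   successor. *)
pose r (f : {ffun 'I_d -> 'I_(l ^ N).+1}) : 'rV[Zl]_d :=
  \row_i ((f i : nat)%:R : Zl).
exists [seq psi (r f) | f : {ffun 'I_d -> 'I_(l ^ N).+1}] => t.
pose f := [ffun i : 'I_d => inord (absz (phi t 0 i N)) : 'I_(l ^ N).+1].
exists (psi (r f)); first by apply/mapP; exists f; rewrite ?mem_enum.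
move=> x xe; have -> : t = (psi (r f) * psi (phi t - r f))%g.
  by rewrite -psiD addrC subrK phiK.
rewrite -[LHS]/(psi (r f) (psi (phi t - r f) x)) (NP _ _ _ xe) // => i.
rewrite !mxE; apply/padic_res_sub; rewrite padic_res_nat ffunE inordK.
  by rewrite gez0_abs ?padic_res_mod // padic_res_ge0.
rewrite ltnS -lez_nat gez0_abs ?padic_res_ge0 // -padic_res_mod.
by rewrite ltW // ltz_pmod // expl_gt0.
Qed.

(** Hilbert 90 for the character given by the i-th coordinate modulo l^n, which by [phi_vanishes] is
    trivial on the automorphisms that fix a finite list [e]. *)
Lemma kummer_character i n : exists b, forall s,
  mg_map s b = b + io (z n *~ phi s 0 i n).
Proof.
have [e eP] := phi_vanishes n; have [S SP] := finite_cover e.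
pose chi s := val (io (z n *~ phi s 0 i n)).
have [||||b b0 bE] := @hilbert90 _ _ _ K e S chi SP.
- move=> s t; rewrite /chi -mgD -raddfD -mulrzDr phiM mxE padic_resD.
  by rewrite (zeta_mod zK).
- by move=> s t; exact: gal_base.
- by move=> t; exact: (valP (io (z n *~ phi t 0 i n))).
- by move=> t te; rewrite /chi eP // mulr0z raddf0.
exists (mg b0) => s; apply: val_inj; rewrite addrC; exact: bE.
Qed.

(** Independence: evaluate the characters at [psi (delta_mx 0 i)]. Generation: the character of a
    rooted [x] is additive and continuous in [c], hence by [padic_linear] a combination of the
    coordinates; subtracting the same combination of the [e i] leaves an element with trivial
    character, whose roots are fixed by the group and so lie in F, which makes it 0. *)
Lemma Zld_zbasis : exists2 e : 'I_d -> H, zbasis rooted_in e &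
  forall s i, kchar io z (mg_map s) (e i) (phi s 0 i).
Proof.
have /choice[e eE] : forall i, exists x, rooted_in x /\
    forall s, kchar io z (mg_map s) x (phi s 0 i).
  move=> i; have [x xr xs] := kchar_element galK (kummer_character i).
  by exists x.
have er i : rooted_in (e i) := (eE i).1.
have es i s : kchar io z (mg_map s) (e i) (phi s 0 i) := (eE i).2 s.
have sat := rooted_in_saturated.
have comb s (c : 'I_d -> Zl) :
    kchar io z (mg_map s) (\sum_i c i *: e i) (\sum_i c i * phi s 0 i).
  suff : rooted_in (\sum_i c i *: e i) /\
    kchar io z (mg_map s) (\sum_i c i *: e i) (\sum_i c i * phi s 0 i) by case.
  pose P x u := rooted_in x /\ kchar io z (mg_map s) x u.
  apply: (big_ind2 P) => [|x u y v [xr xu] [yr yv]|i _].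
  - by split; [exact: rooted0|apply: (kchar0 zK (mg_map_gal_io s))].
  - split; first by apply: rooted_add.
    exact: (kchar_add zK (mg_map_gal_io s)).
  - split; first by apply: rooted_scale; apply: er.
    by apply: (kchar_scale zK (mg_map_gal_io s)); [exact: er|exact: es].
exists e; last by move=> s i; exact: es.
split=> // [x xr|c c0 i]; last first.
  pose s := psi (delta_mx 0 i).
  have : \sum_j c j * phi s 0 j = 0.
    apply: (kchar_unique zK (s := mg_map s) (x := 0)).
    - exact: rooted0.
    - by rewrite -c0; exact: comb.
    - apply: (kchar0 zK (mg_map_gal_io s)).
  rewrite /s psiK (bigD1 i) //= mxE !eqxx mulr1 big1 ?addr0 // => j ji.
  by rewrite mxE (negPf ji) andbF mulr0.
have /choice[u uE] : forall s, exists u, kchar io z (mg_map s) x u.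
  by move=> s; exact: (kchar_exists zK (mg_map_gal_io s)).
pose g c := u (psi c).
have gD c c' : g (c + c') = g c + g c'.
  apply: (kchar_unique zK (s := mg_map (psi (c + c'))) (x := x)) => //; first exact: uE.
  have e2 : mg_map (psi (c + c')) = mg_map (psi c) \o mg_map (psi c')
      :> (mulgroup (subfield K) -> mulgroup (subfield K)).
    by apply/funext => b; apply: val_inj; rewrite /= psiD.
  have := kchar_comp zK (mg_map_gal_io (psi c)) (uE (psi c)) (uE (psi c')).
  by rewrite -e2.
have gB : {morph g : c c' / c - c'}.
  by move=> c c'; apply: (addIr (g c')); rewrite -gD !subrK.
(* Modulo l^k the value is read on a single root [b] at level [k], which [psi c] fixes as soon as
   [c] is near 0. *)
have gcont k : exists N, forall c : 'rV[Zl]_d, (forall i, c 0 i N = 0) -> g c k = 0.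
  have [b xb] := xr k; have [N NP] := psi_fixes [:: val b].
  exists N => c c0; rewrite -[RHS](padic_res0 lP k); apply: (zeta_inj zK).
  apply: (@mg_map_inj _ _ (in_subfield K)); apply: (addrI b).
  rewrite -(uE _ _ _ xb) padic_res0 mulr0z raddf0 addr0; apply: val_inj.
  by apply: NP; rewrite ?mem_head.
exists (fun i => g (delta_mx 0 i)); apply/eqP; rewrite -subr_eq0; apply/eqP.
set y := _ - _; have yr : rooted_in y.
  have [_ MD MZ _] := sat; rewrite /y -scaleN1r; apply: MD => //; apply: MZ.
  exact: saturated_comb.
have ys s : kchar io z (mg_map s) y 0.
  have -> : 0 = u s + (-1) * \sum_i g (delta_mx 0 i) * phi s 0 i.
    rewrite mulN1r -[s in u s]phiK -[u _]/(g (phi s)) (padic_linear gB gcont).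
    by apply/esym/eqP; rewrite subr_eq0; apply/eqP/eq_bigr => i _; rewrite mulrC.
  rewrite /y -scaleN1r; apply: (kchar_add zK (mg_map_gal_io s)) => //.
  - by apply: rooted_scale; exact: (saturated_comb _ sat).
  - exact: uE.
  apply: (kchar_scale zK (mg_map_gal_io s)); last exact: comb.
  exact: (saturated_comb _ sat).
apply: comp_ext => k; have [b yb] := yr k.
have [a e_b] := @mg_map_gal_fixed b galK (fun s => kchar_fixed (ys s) yb).
by move: yb; rewrite e_b comp_res0; exact: (kroot_io_eq0 zK).
Qed.

End ZldExtensions.

(** * The extension attached to a lattice *)

Section KummerExtension.
Variables (l : nat) (lP : prime l) (F L : fieldType) (iota : {rmorphism F -> L}).
Hypothesis sepF : separable_closure iota.
Variable z : nat -> mulgroup F.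
Hypothesis zz : zeta_system l z.
Local Notation Zl := (padic_int lP).
Local Notation H := (completion (mulgroup F) lP).
Local Notation io := (mg_map iota).
Implicit Types (x y : H) (b c : mulgroup L).

Let zL : kummer_system l io z. Proof. exact: zeta_kummer_system. Qed.

Variable M : set H.
Hypothesis Msat : saturated M.

Definition radical b := exists x k, M x /\ kroot io x k b.

Lemma radical_level b c : radical b -> radical c ->
  exists x y k, [/\ M x, M y, kroot io x k b & kroot io y k c].
Proof.
have [_ _ MZ _] := Msat.
move=> [x [k [Mx xb]]] [y [k' [My yc]]].
exists (x *+ (l ^ k')), (y *+ (l ^ k)), (k + k')%N.
split; [by rewrite -scaler_nat; exact: MZ|by rewrite -scaler_nat; exact: MZ| |].
  exact: kroot_shift.
by rewrite addnC; exact: kroot_shift.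
Qed.

Lemma radicalD b c : radical b -> radical c -> radical (b + c).
Proof.
move=> rb rc; have [x [y [k [Mx My xb yc]]]] := radical_level rb rc.
have [_ MD _ _] := Msat.
by exists (x + y), k; split; [exact: MD|exact: kroot_add].
Qed.

Lemma radical_io a : radical (io a).
Proof. by have [M0 _ _ _] := Msat; exists 0, 0%N; split=> //; exact: kroot_io. Qed.

(** Radicals form a group that contains F^*, so their finite sums form a ring that contains F, and
    algebraicity makes it a field. With sums alone, an automorphism is given by its values on
    radicals. *)
Definition kummer_pred : {pred L} := fun w =>
  `[< exists2 s : seq (mulgroup L), {in s, forall b, radical b}
    & w = \sum_(b <- s) val b >].

Lemma kummer_predP w : reflect (exists2 s : seq (mulgroup L),
  {in s, forall b, radical b} & w = \sum_(b <- s) val b) (w \in kummer_pred).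
Proof. exact: asboolP. Qed.

Lemma kummer_radical b : radical b -> val b \in kummer_pred.
Proof.
move=> rb; apply/kummer_predP; exists [:: b]; last by rewrite big_seq1.
by move=> c; rewrite inE => /eqP ->.
Qed.

Lemma kummer_base a : iota a \in kummer_pred.
Proof.
have [->|a0] := eqVneq a 0.
  by apply/kummer_predP; exists [::]; rewrite ?big_nil ?rmorph0.
exact: (kummer_radical (radical_io (mg a0))).
Qed.

Lemma kummer_add w w' :
  w \in kummer_pred -> w' \in kummer_pred -> w + w' \in kummer_pred.
Proof.
move=> /kummer_predP[s rs ->] /kummer_predP[s' rs' ->]; apply/kummer_predP.
exists (s ++ s'); last by rewrite big_cat.
by move=> b; rewrite mem_cat => /orP[/rs|/rs'].
Qed.

Lemma kummer_mul w w' :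
  w \in kummer_pred -> w' \in kummer_pred -> w * w' \in kummer_pred.
Proof.
move=> /kummer_predP[s rs ->] /kummer_predP[s' rs' ->]; apply/kummer_predP.
exists [seq b + c | b <- s, c <- s'].
  by move=> _ /allpairsP[[b c] [/rs rb /rs' rc ->]]; exact: radicalD.
by rewrite big_allpairs_dep mulr_suml; apply: eq_bigr => b _; rewrite mulr_sumr.
Qed.

Fact kummer_divring_closed : divring_closed kummer_pred.
Proof.
split=> [|w w' kw kw'|w w' kw kw'].
- by rewrite -(rmorph1 iota) kummer_base.
- apply: kummer_add => //; rewrite -mulN1r -(rmorphN1 iota).
  exact: kummer_mul (kummer_base _) kw'.
apply: kummer_mul => //.
have [->|w'0] := eqVneq w' 0; first by rewrite invr0 -(rmorph0 iota) kummer_base.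
have [p p0 [pw' _]] := separable_closure_splits sepF w'.
have [q /(canRL (mulKf w'0))] := inv_eq_horner p0 pw' w'0.
rewrite mulr1 => <-; rewrite horner_coef.
apply: (big_ind (fun w => w \in kummer_pred)).
- by rewrite -(rmorph0 iota) kummer_base.
- exact: kummer_add.
move=> i _; rewrite coef_map; apply: kummer_mul; first exact: kummer_base.
elim: (i : nat) => [|n IHn]; first by rewrite expr0 -(rmorph1 iota) kummer_base.
by rewrite exprS kummer_mul.
Qed.

Definition kummer_ext : subextension iota :=
  SubExtension kummer_divring_closed kummer_base.

Lemma radical_aut (s : L -> L) b : field_aut iota s -> radical b ->
  exists a, s (val b) = val (b + io a).
Proof.
move=> sA [x [k [_ [a ba _]]]]; have [t st] := field_aut_rmorphism sA.
have [_ _ s1 _] := sA.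
have [|j e] := @kummer_torsion _ _ _ _ _ zL (mg_map t b - b) k.
  rewrite mulrnBl -raddfMn /= ba.
  suff -> : mg_map t (io a) = io a by rewrite subrr.
  by apply: val_inj; rewrite /= -st s1.
exists (z k *~ j); rewrite -e addrC subrK.
exact: st.
Qed.

Lemma field_aut_kummer (s : L -> L) w : field_aut iota s ->
  w \in kummer_pred -> s w \in kummer_pred.
Proof.
move=> sA /kummer_predP[t rt ->]; have [s' ss'] := field_aut_rmorphism sA.
rewrite ss' rmorph_sum big_seq.
apply: (big_ind (fun w => w \in kummer_pred)).
- by rewrite -(rmorph0 iota) kummer_base.
- exact: kummer_add.
move=> b /rt rb; have [a e] := radical_aut sA rb; rewrite -ss' e.
by apply: kummer_radical; apply: radicalD => //; exact: radical_io.
Qed.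

Lemma kummer_galois : galois_ext kummer_ext.
Proof.
split=> [w _|p irr [w kw pw]]; first exact: sepF.1.
have [q q0 [qw [rs qrs]]] := separable_closure_splits sepF w.
have /dvdp_prod_XsubC[m eqm] : map_poly iota p %| \prod_(x <- rs) ('X - x%:P).
  rewrite -(eqp_dvdr _ qrs) dvdp_map.
  exact: irreducible_dvd_annihilator irr pw qw.
exists (mask m rs) => // v; rewrite -root_prod_XsubC -(eqp_root eqm) => pv.
have [s sA <-] := field_aut_transitive (separable_closure_splits sepF) irr pw pv.
exact: field_aut_kummer.
Qed.

Let same_class b c := `[< exists a, b = c + io a >].

(* Elements of distinct classes modulo F^* are eigenvectors for distinct
   characters of the automorphism group of L, hence linearly independent. *)
Lemma radical_independence (s : seq (F * mulgroup L)) (chi : mulgroup L -> F) :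
  {in s, forall fb, radical fb.2} ->
  (forall b c, radical b -> radical c -> (exists a, b = c + io a) ->
    chi b = chi c) ->
  \sum_(fb <- s) iota fb.1 * val fb.2 = 0 ->
  \sum_(fb <- s) iota (fb.1 * chi fb.2) * val fb.2 = 0.
Proof.
have [n] := ubnP (size s); elim: n s chi => // n IHn s chi le_s rs chiP sum0.
case: s le_s rs sum0 => [|[f0 b0] s]; first by rewrite !big_nil.
set S := (f0, b0) :: s => le_S rS sum0.
have rb0 : radical b0 by exact: (rS (f0, b0) (mem_head _ _)).
(* With a single class [chi] is constant on the terms of [S], and the twisted relation is a multiple
   of the given one. *)
have [all_same|] := pselect ({in S, forall fb, same_class fb.2 b0}).
  transitivity (iota (chi b0) * \sum_(fb <- S) iota fb.1 * val fb.2);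
    last by rewrite sum0 mulr0.
  rewrite mulr_sumr; apply: eq_big_seq => fb fbS.
  rewrite (chiP _ b0 (rS _ fbS) rb0); last by apply/asboolP; exact: all_same.
  by rewrite rmorphM [iota fb.1 * _]mulrC mulrA.
move=> /existsNP[[f1 b1]] /not_implyP[b1S /= ns].
have nb1 : ~ exists a, b1 = b0 + io a by move=> ex; apply: ns; apply/asboolP.
have rb1 : radical b1 := rS _ b1S.
have [p [_ sep px]] := sepF.1 (val (b1 - b0)).
have nrange : ~ range iota (val (b1 - b0)).
  move=> [a _ e]; apply: nb1; have a0 : a != 0.
    by rewrite -(fmorph_eq0 iota) e (valP (b1 - b0)).
  exists (mg a0); rewrite -[b1](subrK b0) addrC; congr (_ + _).
  by apply: val_inj; rewrite -[LHS]e.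
(* [t] moves the quotient of [b1] by [b0], so the factors [w b1] and [w b0] by which it multiplies
   them are distinct. *)
have [t tA tb] :=
  field_aut_moves (separable_closure_splits sepF) sep px nrange.
have [t' tt'] := field_aut_rmorphism tA; have [_ _ t1 _] := tA.
have /choice[w wE] : forall b, exists a, radical b -> mg_map t' b = b + io a.
  move=> b; have [rb|nb] := pselect (radical b); last by exists 0.
  have [a e] := radical_aut tA rb; exists a => _.
  by apply: val_inj; rewrite -e /= tt'.
have t'io a : mg_map t' (io a) = io a by apply: val_inj; rewrite /= -tt' t1.
have w_inv b c : radical b -> radical c -> (exists a, b = c + io a) -> w b = w c.
  move=> rb rc [a e]; have := wE b rb.
  rewrite {1 2}e raddfD /= t'io wE // addrAC => /addrI/mg_map_inj.
  exact: esym.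
have w01 : val (w b1) - val (w b0) != 0.
  rewrite subr_eq0; apply/eqP => /val_inj e; apply: tb.
  have : mg_map t' (b1 - b0) = b1 - b0.
    by rewrite raddfB /= !wE // e opprD addrACA subrr addr0.
  by move=> /(congr1 val); rewrite -[LHS]/(t' (val (b1 - b0))) -tt'.
have sc b c : radical b -> radical c -> (exists a, b = c + io a) ->
    same_class b b1 = same_class c b1.
  move=> rb rc [a e]; apply/asboolP/asboolP => -[a' e'].
    exists (a' - a); rewrite raddfB /= addrA -e' e; by rewrite addrK.
  by exists (a' + a); rewrite raddfD /= addrA -e'.
(* Applying [t] and subtracting [w b0] times the relation removes the head term, so that the
   induction hypothesis applies to what remains. *)
have sum2 : \sum_(fb <- s) iota (fb.1 * (val (w fb.2) - val (w b0))) * val fb.2 = 0.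
  have : \sum_(fb <- S) iota (fb.1 * (val (w fb.2) - val (w b0))) * val fb.2 = 0.
    transitivity (t' (\sum_(fb <- S) iota fb.1 * val fb.2) -
        iota (val (w b0)) * \sum_(fb <- S) iota fb.1 * val fb.2); last first.
      by rewrite sum0 rmorph0 mulr0 subrr.
    rewrite rmorph_sum mulr_sumr -sumrB; apply: eq_big_seq => fb /rS rb.
    rewrite [t' _]rmorphM -(tt' (iota _)) t1 -[t' _]/(val (mg_map t' fb.2)) wE //.
    rewrite mgD [iota (_ * _)]rmorphM rmorphB mulrBr mulrBl -!mulrA.
    by rewrite [val fb.2 * _]mulrC [iota (val (w b0)) * _]mulrCA.
  by rewrite big_cons subrr mulr0 rmorph0 mul0r add0r.
(* The indicator of the class of [b1]. On that class [w] is constant, so the shorter relation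
   twisted by [chi1] is a nonzero multiple of the part of the original relation that lies in the
   class. *)
pose chi1 b : F := if same_class b b1 then 1 else 0.
have sumc : \sum_(fb <- S) iota (fb.1 * chi1 fb.2) * val fb.2 = 0.
  rewrite big_cons /chi1 /= ifF; last first.
    apply/negP => /asboolP[a e]; apply: nb1; exists (- a).
    by rewrite raddfN /= e addrK.
  rewrite mulr0 rmorph0 mul0r add0r.
  have rs fb : fb \in s -> radical fb.2.
    by move=> fbs; apply: rS; rewrite in_cons fbs orbT.
  have : \sum_(fb <- [seq (fb.1 * (val (w fb.2) - val (w b0)), fb.2) | fb <- s])
      iota (fb.1 * chi1 fb.2) * val fb.2 = 0.
    apply: IHn.
    - by rewrite size_map; exact: le_S.
    - by move=> _ /mapP[fb /rs rb ->].
    - by move=> b c rb rc e; rewrite /chi1 (sc b c).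
    - by rewrite big_map; exact: sum2.
  rewrite big_map => e.
  have iw0 : iota (val (w b1) - val (w b0)) != 0 by rewrite fmorph_eq0.
  apply: (mulfI iw0); rewrite mulr0 -[RHS]e mulr_sumr.
  apply: eq_big_seq => fb /rs rb; rewrite /chi1.
  case: ifP => [/asboolP/(w_inv _ _ rb rb1) e'|_].
    by rewrite /= e' !mulr1 mulrA -rmorphM mulrC [_ * fb.1]mulrC mulrC.
  by rewrite !mulr0 rmorph0 mul0r mulr0.
(* The class of [b1] sums to 0 by itself; the other terms form a shorter relation, to which
   induction applies with [chi]. *)
rewrite (bigID (fun fb => same_class fb.2 b1)) /=.
rewrite [X in X + _](_ : _ = 0) ?add0r; last first.
  transitivity (iota (chi b1) * \sum_(fb <- S) iota (fb.1 * chi1 fb.2) * val fb.2);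
    last by rewrite sumc mulr0.
  rewrite mulr_sumr big_mkcond; apply: eq_big_seq => fb /rS rb.
  rewrite /chi1; case: ifP => [/asboolP/(chiP _ _ rb rb1) ->|_].
    by rewrite mulr1 rmorphM mulrAC mulrA [iota (chi b1) * _]mulrC mulrAC.
  by rewrite mulr0 rmorph0 mul0r mulr0.
rewrite -big_filter; apply: IHn => //.
- rewrite size_filter; apply: (@leq_trans (size S)); last exact: le_S.
  rewrite ltn_neqAle count_size andbT -all_count.
  apply/allPn; exists (f1, b1) => //=; rewrite negbK.
  by apply/asboolP; exists 0; rewrite raddf0 addr0.
- by move=> fb; rewrite mem_filter => /andP[_ /rS].
transitivity (\sum_(fb <- S) iota fb.1 * val fb.2 -
    \sum_(fb <- S) iota (fb.1 * chi1 fb.2) * val fb.2); last first.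
  by rewrite sum0 sumc subrr.
rewrite big_filter big_mkcond -sumrB; apply: eq_big_seq => fb _.
by rewrite /chi1; case: (same_class _ _);
  rewrite /= ?mulr0 ?mulr1 ?rmorph0 ?mul0r ?subr0 ?subrr.
Qed.

End KummerExtension.

(** * The Galois group of the Kummer extension *)

Section KummerGaloisGroup.
Variables (l : nat) (lP : prime l) (F L : fieldType) (iota : {rmorphism F -> L}).
Hypothesis charF : l \notin [pchar F].
Hypothesis sepF : separable_closure iota.
Variable z : nat -> mulgroup F.
Hypothesis zz : zeta_system l z.
Local Notation Zl := (padic_int lP).
Local Notation H := (completion (mulgroup F) lP).
Local Notation io := (mg_map iota).

Let zL : kummer_system l io z. Proof. exact: zeta_kummer_system. Qed.

Variable M : set H.
Hypothesis Msat : saturated M.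
Variables (d : nat) (e : 'I_d -> H).
Hypothesis eb : zbasis M e.
Implicit Types (b : mulgroup L) (c : 'rV[Zl]_d) (y : 'I_d -> Zl) (w : L).

Local Notation radical := (radical iota M).
Local Notation kummer_pred := (kummer_pred iota M).
Local Notation K := (kummer_ext sepF Msat).

Let comb y : H := \sum_i y i *: e i.
Let dot c y : Zl := \sum_i c 0 i * y i.

Let combB y y' : comb (fun i => y i - y' i) = comb y - comb y'.
Proof. by rewrite /comb -sumrB; apply: eq_bigr => i _; rewrite scalerBl. Qed.

Let combD y y' : comb (fun i => y i + y' i) = comb y + comb y'.
Proof. by rewrite /comb -big_split; apply: eq_bigr => i _; rewrite scalerDl. Qed.

Let combZ r y : comb (fun i => r * y i) = r *: comb y.
Proof. by rewrite /comb scaler_sumr; apply: eq_bigr => i _; rewrite scalerA. Qed.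

Let dotB c y y' : dot c (fun i => y i - y' i) = dot c y - dot c y'.
Proof. by rewrite /dot -sumrB; apply: eq_bigr => i _; rewrite mulrBr. Qed.

Let dotD c y y' : dot c (fun i => y i + y' i) = dot c y + dot c y'.
Proof. by rewrite /dot -big_split; apply: eq_bigr => i _; rewrite mulrDr. Qed.

Let dotZ c r y : dot c (fun i => r * y i) = r * dot c y.
Proof. by rewrite /dot mulr_sumr; apply: eq_bigr => i _; rewrite mulrCA. Qed.

Let comb_inj y y' : comb y = comb y' -> forall i, y i = y' i.
Proof.
case: eb => _ _ ind yy' i; apply/eqP; rewrite -subr_eq0; apply/eqP.
by apply: (ind (fun i => y i - y' i)); rewrite -/(comb _) combB yy' subrr.
Qed.

Let radical_comb b : radical b -> exists k y, kroot io (comb y) k b.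
Proof.
by case: eb => _ gen _ [x [k [/gen[y ->] xb]]]; exists k, y.
Qed.

Let comb_radical k y b : kroot io (comb y) k b -> radical b.
Proof.
by case: eb => Me _ _ yb; exists (comb y), k; split=> //; exact: saturated_comb.
Qed.

Lemma zeta_level k n (u : Zl) :
  z k *~ u k = z (k + n)%N *~ ((l ^ n)%:R * u) (k + n)%N.
Proof.
rewrite padic_resM padic_res_nat modzMml (zeta_mod zL) mulrzA -pmulrn.
by rewrite (zeta_shift zL) -[RHS](zeta_mod zL) padic_res_shift.
Qed.

(** A radical can arise from several [y] and levels. At the common level [k + k'] the two
    combinations agree, so their difference is l^(k + k') times some [h]; saturation puts [h] in
    [M], and the coordinates are then congruent modulo l^(k + k'). *)
Let chi_level c k k' y y' b : kroot io (comb y) k b -> kroot io (comb y') k' b ->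
  z k *~ dot c y k = z k' *~ dot c y' k'.
Proof.
move=> /(kroot_shift k') yb /(kroot_shift k) y'b.
rewrite (zeta_level k k') (zeta_level k' k) [(k' + k)%N]addnC.
rewrite [(k' + k)%N]addnC in y'b; move: yb y'b.
rewrite -!scaler_nat -!combZ => yb y'b.
have e0 := kroot_fun zL yb y'b.
have [h eh] : exists h, comb (fun i => (l ^ k')%:R * y i - (l ^ k)%:R * y' i) =
    h *+ (l ^ (k + k')).
  apply: comp_div; first by move=> a n m; exact: (base_torsion_div zL).
  by rewrite combB comp_resD comp_resN e0 subrr.
have [Me gen _] := eb; have [_ _ _ MS] := Msat.
have /gen[v hv] : M h.
  apply: (MS _ _ (padic_natl_neq0 lP (k + k')%N)).
  by rewrite scaler_nat -eh; exact: saturated_comb.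
move: eh; rewrite hv -/(comb v) -scaler_nat -combZ => /comb_inj ev.
congr (_ *~ _); rewrite -!dotZ; apply/padic_res_sub; rewrite -dotB.
have -> : dot c (fun i => (l ^ k')%:R * y i - (l ^ k)%:R * y' i) =
    (l ^ (k + k'))%:R * dot c v.
  by rewrite -dotZ; apply: eq_bigr => i _; rewrite ev.
exact: padic_res_mul_eq0.
Qed.

Let chi_ex c : exists f : mulgroup L -> mulgroup F, forall b k y,
  kroot io (comb y) k b -> f b = z k *~ dot c y k.
Proof.
suff /choice[f fE] : forall b, exists a, forall k y,
    kroot io (comb y) k b -> a = z k *~ dot c y k by exists f.
move=> b; have [[k [y yb]]|nb] := pselect (exists k y, kroot io (comb y) k b).
  by exists (z k *~ dot c y k) => k' y' y'b; exact: chi_level yb y'b.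
by exists 0 => k y yb; case: nb; exists k, y.
Qed.

(** The root of unity by which the automorphism with coordinates [c] has to multiply a given
    radical. *)
Definition kummer_chi c : mulgroup L -> mulgroup F := projT1 (cid (chi_ex c)).
Local Notation chi := kummer_chi.

Let chiE c b k y : kroot io (comb y) k b -> chi c b = z k *~ dot c y k.
Proof. exact: (projT2 (cid (chi_ex c))). Qed.

Let chiD c b b' : radical b -> radical b' -> chi c (b + b') = chi c b + chi c b'.
Proof.
move=> rb rb'; have [x [x' [k [Mx Mx' xb xb']]]] := radical_level Msat rb rb'.
have [_ gen _] := eb; have [y ey] := gen _ Mx; have [y' ey'] := gen _ Mx'.
rewrite ey in xb; rewrite ey' in xb'.
have : kroot io (comb (fun i => y i + y' i)) k (b + b').
  by rewrite combD; exact: kroot_add.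
move=> /chiE ->; rewrite (chiE c xb) (chiE c xb') dotD.
by rewrite padic_resD (zeta_mod zL) mulrzDr.
Qed.

Let chi_io c a : chi c (io a) = 0.
Proof.
have : kroot io (comb (fun=> 0)) 0 (io a).
  by rewrite /comb big1 => [|i _]; rewrite ?scale0r //; exact: kroot_io.
move=> /chiE ->; rewrite /dot big1 => [|i _]; last by rewrite mulr0.
by rewrite padic_res0 mulr0z.
Qed.

Let chi_addl c c' b : radical b -> chi (c + c') b = chi c b + chi c' b.
Proof.
move=> /radical_comb[k [y yb]]; rewrite !(chiE _ yb).
have -> : dot (c + c') y = dot c y + dot c' y.
  by rewrite /dot -big_split; apply: eq_bigr => i _; rewrite mxE mulrDl.
by rewrite padic_resD (zeta_mod zL) mulrzDr.
Qed.

Let chi0 b : radical b -> chi 0 b = 0.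
Proof.
move=> /radical_comb[k [y yb]]; rewrite (chiE _ yb) /dot big1 => [|i _].
  by rewrite padic_res0 mulr0z.
by rewrite mxE mul0r.
Qed.

Let rad_shift c b : radical b -> radical (b + io (chi c b)).
Proof. by move=> rb; apply: radicalD => //; exact: radical_io. Qed.

Let twist c (s : seq (mulgroup L)) : L := \sum_(b <- s) val (b + io (chi c b)).
Let all_rad (s : seq (mulgroup L)) := {in s, forall b, radical b}.

(** Apply [radical_independence] to the difference of the two sums, with coefficients 1 and -1: the
    relation survives when each term is multiplied by its value of [chi c], which depends only on
    its class modulo F^*. *)
Let twist_wd c s s' : all_rad s -> all_rad s' ->
  \sum_(b <- s) val b = \sum_(b <- s') val b -> twist c s = twist c s'.
Proof.
move=> rs rs' ess'; apply/eqP; rewrite -subr_eq0; apply/eqP.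
pose S : seq (F * mulgroup L) := [seq (1, b) | b <- s] ++ [seq (-1, b) | b <- s'].
have : \sum_(fb <- S) iota (fb.1 * val (chi c fb.2)) * val fb.2 = 0.
  apply: (radical_independence sepF zz (M := M) (chi := fun b => val (chi c b))).
  - by move=> fb; rewrite mem_cat => /orP[] /mapP[b] => [/rs|/rs'] rb ->.
  - by move=> b b' rb rb' [a ->]; rewrite chiD ?chi_io ?addr0 //; exact: radical_io.
  - move: ess'; rewrite big_cat !big_map /= -!mulr_sumr => ->.
    by rewrite rmorph1 rmorphN1 mulN1r mul1r subrr.
rewrite big_cat !big_map /= => <-; rewrite /twist -sumrN.
congr (_ + _); apply: eq_bigr => b _; rewrite mgD /=.
  by rewrite mul1r mulrC.
by rewrite mulN1r rmorphN mulNr mulrC.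
Qed.

Let sigma_ex c : exists f : L -> L, forall s, all_rad s ->
  f (\sum_(b <- s) val b) = twist c s.
Proof.
suff /choice[f fE] : forall w, exists v, forall s, all_rad s ->
    w = \sum_(b <- s) val b -> v = twist c s.
  by exists f => s rs; exact: fE.
move=> w; have [[s [rs es]]|nw] :=
    pselect (exists s, all_rad s /\ w = \sum_(b <- s) val b).
  by exists (twist c s) => s' rs' es'; apply: twist_wd => //; rewrite -es.
by exists 0 => s rs es; case: nw; exists s.
Qed.

Let sigma c : L -> L := projT1 (cid (sigma_ex c)).

Let sigmaE c s : all_rad s -> sigma c (\sum_(b <- s) val b) = twist c s.
Proof. exact: (projT2 (cid (sigma_ex c))). Qed.

Let sigma_radical c b : radical b -> sigma c (val b) = val (b + io (chi c b)).
Proof.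
move=> rb; have := @sigmaE c [:: b]; rewrite /twist !big_seq1; apply.
by move=> b'; rewrite inE => /eqP ->.
Qed.

Let twist_rad c s : all_rad s -> all_rad [seq b + io (chi c b) | b <- s].
Proof. by move=> rs _ /mapP[b /rs rb ->]; exact: rad_shift. Qed.

Let sigma_in c w : w \in kummer_pred -> sigma c w \in kummer_pred.
Proof.
move=> /kummer_predP[s rs ->]; rewrite sigmaE //; apply/kummer_predP.
by exists [seq b + io (chi c b) | b <- s]; [exact: twist_rad|rewrite big_map].
Qed.

Let sigmaD c w w' : w \in kummer_pred -> w' \in kummer_pred ->
  sigma c (w + w') = sigma c w + sigma c w'.
Proof.
move=> /kummer_predP[s rs ->] /kummer_predP[s' rs' ->].
rewrite -big_cat !sigmaE //; first by rewrite /twist big_cat.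
by move=> b; rewrite mem_cat => /orP[/rs|/rs'].
Qed.

Let sigmaM c w w' : w \in kummer_pred -> w' \in kummer_pred ->
  sigma c (w * w') = sigma c w * sigma c w'.
Proof.
move=> /kummer_predP[s rs ->] /kummer_predP[s' rs' ->].
have -> : (\sum_(b <- s) val b) * (\sum_(b <- s') val b) =
    \sum_(b <- [seq b + b' | b <- s, b' <- s']) val b.
  by rewrite big_allpairs_dep mulr_suml; apply: eq_bigr => b _; rewrite mulr_sumr.
rewrite !sigmaE //; last first.
  by move=> _ /allpairsP[[b b'] [/rs rb /rs' rb' ->]]; exact: radicalD.
rewrite /twist big_allpairs_dep mulr_suml; apply: eq_big_seq => b /rs rb.
rewrite mulr_sumr; apply: eq_big_seq => b' /rs' rb'.
by rewrite chiD // raddfD addrACA.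
Qed.

Let sigma_base c a : sigma c (iota a) = iota a.
Proof.
have [->|a0] := eqVneq a 0.
  by have := @sigmaE c [::]; rewrite /twist !big_nil rmorph0; apply.
have := @sigma_radical c (io (mg a0)) (radical_io iota Msat _).
by rewrite chi_io raddf0 addr0.
Qed.

Let sigma_comp c c' w : w \in kummer_pred ->
  sigma c (sigma c' w) = sigma (c + c') w.
Proof.
move=> /kummer_predP[s rs ->]; rewrite !sigmaE // {2}/twist.
have := @sigmaE c [seq b + io (chi c' b) | b <- s]; rewrite big_map => ->.
  rewrite /twist big_map; apply: eq_big_seq => b /rs rb.
  rewrite chiD //; last exact: radical_io.
  by rewrite chi_io addr0 chi_addl // raddfD -addrA [io _ + _]addrC.
exact: twist_rad.
Qed.

Let sigma0 w : w \in kummer_pred -> sigma 0 w = w.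
Proof.
move=> /kummer_predP[s rs ->]; rewrite sigmaE //.
by apply: eq_big_seq => b /rs rb; rewrite chi0 // raddf0 addr0.
Qed.

Let ksigma c (w : subfield K) : subfield K :=
  exist _ (sigma c (val w)) (sigma_in c (valP w)).

Let ksigmaK c : cancel (ksigma c) (ksigma (- c)).
Proof.
move=> w; apply: val_inj; rewrite /= sigma_comp ?addNr ?sigma0 //; exact: (valP w).
Qed.

Definition kummer_aut c : gal K.
Proof.
exists (ksigma c) => [w w'|w w'|a|].
- by apply: val_inj; apply: sigmaD; [exact: (valP w)|exact: (valP w')].
- by apply: val_inj; apply: sigmaM; [exact: (valP w)|exact: (valP w')].
- by apply: val_inj; exact: sigma_base.
- exists (ksigma (- c)); first exact: ksigmaK.
  by move=> w; rewrite -{1}[c]opprK ksigmaK.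
Defined.

Local Notation ioK := (mg_map (in_subfield K)).

Let zK : kummer_system l ioK z. Proof. exact: zeta_kummer_system. Qed.

Lemma radical_in_kummer b : radical b ->
  exists b' : mulgroup (subfield K), mg_map (@subfield_val _ _ _ K) b' = b.
Proof.
move=> rb; pose w : subfield K := exist _ (val b) (kummer_radical rb).
have w0 : w != 0 by rewrite -(fmorph_eq0 (@subfield_val _ _ _ K)) (valP b).
by exists (mg w0); apply: val_inj.
Qed.

Lemma kummer_rooted (x : H) : M x -> rooted ioK x.
Proof.
move=> Mx k; have [b xb] :=
  kroot_exists io x k (mulgroup_l_divisible lP charF sepF).
have [|b' e'] := @radical_in_kummer b; first by exists x, k.
by exists b'; apply/kroot_subfield; rewrite e'.
Qed.

Lemma kummer_gal_eq (s t : gal K) :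
  (forall b : mulgroup (subfield K), radical (mg_map (@subfield_val _ _ _ K) b) ->
    mg_map s b = mg_map t b) -> s = t.
Proof.
move=> st; apply: gal_ext => w.
have /kummer_predP[r rr] := valP w; elim: r w rr => [|b r IHr] w rr.
  rewrite big_nil => w0; have -> : w = 0 by apply: val_inj.
  by rewrite !rmorph0.
rewrite big_cons => ew.
have rb : radical b by apply: rr; rewrite mem_head.
have [b' eb'] := radical_in_kummer rb.
rewrite -(subrK (val b') w) !(galD _ (w - val b')) IHr.
- congr (_ + _); have := st b'; rewrite eb' => /(_ rb)/(congr1 val); exact.
- by move=> b0 b0r; apply: rr; rewrite in_cons b0r orbT.
rewrite rmorphB /= ew -[sval (val b')]/(val (mg_map (@subfield_val _ _ _ K) b')).
by rewrite eb' addrC addKr.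
Qed.

Lemma kummer_aut_char c i : kchar ioK z (mg_map (kummer_aut c)) (e i) (c 0 i).
Proof.
move=> k b eb'; apply: (@mg_map_inj _ _ (@subfield_val _ _ _ K)).
have /kroot_subfield rb := eb'.
have ei : e i = comb (fun j => (j == i)%:R).
  rewrite /comb (bigD1 i) //= eqxx scale1r big1 ?addr0 // => j /negPf ->.
  by rewrite scale0r.
have dc : dot c (fun j => (j == i)%:R) = c 0 i.
  rewrite /dot (bigD1 i) //= eqxx mulr1 big1 ?addr0 // => j /negPf ->.
  by rewrite mulr0.
rewrite ei in rb; rewrite raddfD /= -dc -(chiE c rb).
apply: val_inj; rewrite /= -[LHS]/(sigma c (val (mg_map (@subfield_val _ _ _ K) b))).
by rewrite sigma_radical //; exact: comb_radical rb.
Qed.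

Let kchar_phi_ex (s : gal K) : exists c, forall i, kchar ioK z (mg_map s) (e i) (c 0 i).
Proof.
have /choice[u uE] : forall i, exists u, kchar ioK z (mg_map s) (e i) u.
  move=> i; apply: (kchar_exists zK (mg_map_gal_io s)); apply: kummer_rooted.
  by case: eb.
by exists (\row_i u i) => i; rewrite mxE.
Qed.

Definition kummer_phi (s : gal K) : 'rV[Zl]_d := projT1 (cid (kchar_phi_ex s)).

Lemma kummer_phiE (s : gal K) i : kchar ioK z (mg_map s) (e i) (kummer_phi s 0 i).
Proof. exact: (projT2 (cid (kchar_phi_ex s)) i). Qed.

Let kummer_phi_unique (s : gal K) c :
  (forall i, kchar ioK z (mg_map s) (e i) (c 0 i)) -> kummer_phi s = c.
Proof.
move=> sc; apply/rowP => i; apply: (kchar_unique zK _ (@kummer_phiE s i) (sc i)).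
by apply: kummer_rooted; case: eb.
Qed.

Let kummer_phi_radical (s : gal K) k y (b : mulgroup (subfield K)) :
  kroot io (comb y) k (mg_map (@subfield_val _ _ _ K) b) ->
  mg_map s b = b + ioK (z k *~ dot (kummer_phi s) y k).
Proof.
move=> /kroot_subfield yb.
suff [_ ] : rooted ioK (comb y) /\
    kchar ioK z (mg_map s) (comb y) (dot (kummer_phi s) y) by apply.
pose P (x : H) (u : Zl) := rooted ioK x /\ kchar ioK z (mg_map s) x u.
rewrite /comb /dot.
apply: (big_ind2 P) => [|x u x' u' [xr xu] [xr' xu']|i _].
- by split; [exact: rooted0|apply: (kchar0 zK (mg_map_gal_io s))].
- by split; [exact: rooted_add|apply: (kchar_add zK (mg_map_gal_io s))].
- have er : rooted ioK (e i) by apply: kummer_rooted; case: eb.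
  split; first exact: rooted_scale.
  by rewrite mulrC; apply: (kchar_scale zK (mg_map_gal_io s)) => //; exact: kummer_phiE.
Qed.

Let kummer_phiK : cancel kummer_phi kummer_aut.
Proof.
move=> s; apply: kummer_gal_eq => b /radical_comb[k [y yb]].
rewrite (kummer_phi_radical _ yb) (kummer_phi_radical s yb).
by rewrite (kummer_phi_unique (kummer_aut_char _)).
Qed.

Let kummer_autK : cancel kummer_aut kummer_phi.
Proof. by move=> c; apply: kummer_phi_unique; exact: kummer_aut_char. Qed.

Lemma kummer_phiM : {morph kummer_phi : s t / (s * t)%g >-> s + t}.
Proof.
move=> s t; apply: kummer_phi_unique => i; rewrite mxE.
have e2 : mg_map (s * t)%g = mg_map s \o mg_map t
    :> (mulgroup (subfield K) -> mulgroup (subfield K)).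
  by apply/funext => b; apply: val_inj.
have := kchar_comp zK (mg_map_gal_io s) (@kummer_phiE s i) (@kummer_phiE t i).
by rewrite -e2.
Qed.

Lemma kummer_phi_continuous : continuous kummer_phi.
Proof.
move=> s A /nbhs_mxP[N NA].
have /choice[b bE] : forall i,
    exists b : mulgroup (subfield K), kroot ioK (e i) N b.
  by move=> i; apply: kummer_rooted; case: eb.
exists [seq val (b i) | i : 'I_d] => t ts; apply: NA => i.
apply: (zeta_inj zK); apply: (@mg_map_inj _ _ (in_subfield K)).
apply: (addrI (b i)).
rewrite -(@kummer_phiE t i _ _ (bE i)) -(@kummer_phiE s i _ _ (bE i)).
apply: val_inj; apply: ts; apply/mapP; exists i => //; exact: mem_enum.
Qed.

(** An element is a finite sum of radicals, and a radical at level [k] sees [c] only modulo l^k. *)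
Let kummer_aut_locally_constant c (w : subfield K) : exists N, forall c' : 'rV[Zl]_d,
  (forall i, c' 0 i N = c 0 i N) -> kummer_aut c' w = kummer_aut c w.
Proof.
have /kummer_predP[r rr ew] := valP w.
suff [N NP] : exists N, forall c' : 'rV[Zl]_d,
    (forall i, c' 0 i N = c 0 i N) -> twist c' r = twist c r.
  by exists N => c' cc'; apply: val_inj; rewrite /= ew !sigmaE // NP.
elim: r rr {ew} => [|b r IHr] rr; first by exists 0%N => c' _; rewrite /twist !big_nil.
have [|N NP] := IHr; first by move=> b0 b0r; apply: rr; rewrite in_cons b0r orbT.
have /radical_comb[k [y yb]] : radical b by apply: rr; rewrite mem_head.
exists (maxn N k) => c' cc'; have le n : (n <= maxn N k)%N ->
    forall i, c' 0 i n = c 0 i n.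
  by move=> le_n i; apply: res_leq le_n (cc' i).
rewrite /twist !big_cons -!/(twist _ _) NP; last by apply: le; exact: leq_maxl.
congr (val (_ + io _) + _); rewrite !(chiE _ yb); congr (_ *~ _).
apply/padic_res_sub; have /choice[v vE] : forall i, exists v,
    c' 0 i - c 0 i = (l ^ k)%:R * v.
  by move=> i; apply: padic_dvd; apply/padic_res_sub/le; exact: leq_maxr.
have -> : dot c' y - dot c y = (l ^ k)%:R * \sum_i v i * y i.
  rewrite /dot -sumrB mulr_sumr; apply: eq_bigr => i _.
  by rewrite mulrA -vE mulrBl.
exact: padic_res_mul_eq0.
Qed.

Lemma kummer_aut_continuous : continuous kummer_aut.
Proof.
move=> c A [r rA].
suff [N NP] : exists N, forall c' : 'rV[Zl]_d, (forall i, c' 0 i N = c 0 i N) ->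
    {in r, kummer_aut c' =1 kummer_aut c}.
  by apply: (mxP_nbhs (N := N)) => c' /NP /rA.
elim: r {rA} => [|w r [N NP]]; first by exists 0%N.
have [k kP] := kummer_aut_locally_constant c w.
exists (maxn N k) => c' cc' v; rewrite in_cons => /predU1P[->|vr].
  by apply: kP => i; apply: res_leq (cc' i); exact: leq_maxr.
by apply: NP => // i; apply: res_leq (cc' i); exact: leq_maxl.
Qed.

Lemma kummer_ext_Zld : Zld_extension iota lP d K.
Proof.
split; first exact: (kummer_galois sepF zz).
exists kummer_phi, kummer_aut; split.
- exact: kummer_phiM.
- exact: kummer_phiK.
- exact: kummer_autK.
- exact: kummer_phi_continuous.
- exact: kummer_aut_continuous.
Qed.

End KummerGaloisGroup.

(** * The correspondence *)

Section Correspondence.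
Variables (l : nat) (lP : prime l) (F L : fieldType) (iota : {rmorphism F -> L}).
Variable z : nat -> mulgroup F.
Hypothesis zz : zeta_system l z.
Local Notation H := (completion (mulgroup F) lP).
Local Notation io := (mg_map iota).
Implicit Types K : subextension iota.

Lemma subextension_eq K K' : K =i K' -> K = K'.
Proof.
case: K K' => [p pD pb] [q qD qb] pq.
have e : p = q by apply/funext => w; exact: pq.
by subst q; congr SubExtension; exact: Prop_irrelevance.
Qed.

Lemma mulgroup_torsion_div (a : mulgroup F) k n :
  a *+ (l ^ k) = 0 -> exists b, a = b *+ (l ^ n).
Proof. exact: (base_torsion_div (zeta_kummer_system lP iota zz)). Qed.

(** K contains a root at each level for each class in [rooted_in K]; any other root in L differs
    from it by an element of F^*. *)
Lemma rooted_in_radical K w :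
  w \in kummer_pred iota (rooted_in (lP := lP) K) -> w \in K.
Proof.
move=> /kummer_predP[s rs ->]; rewrite big_seq.
apply: rpred_sum => b /rs[x [k [xr xb]]].
have [b' /kroot_subfield xb'] := xr k.
have : kroot io (0 : H) k (b - mg_map (@subfield_val _ _ _ K) b').
  by rewrite -(subrr x); exact: kroot_sub.
move=> /(kroot0 (zeta_kummer_system lP iota zz))[a e].
rewrite -(subrK (mg_map (@subfield_val _ _ _ K) b') b) e mgD.
by apply: rpredM; [exact: subext_base|exact: (valP (val b'))].
Qed.

(** Otherwise some automorphism [t] of K moves an element and fixes the field generated by the
    radicals; its characters on the basis [e] vanish, so [phi t = 0] and [t] is trivial. Thus
    [rooted_in K] determines K, whence the injectivity of the correspondence. *)
Lemma Zld_kummer K (sepF : separable_closure iota) d :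
  Zld_extension iota lP d K -> K =i kummer_pred iota (rooted_in (lP := lP) K).
Proof.
move=> [galK [phi [psi [phiM phiK psiK phic psic]]]] w.
have [e [er gen ind] ephi] := Zld_zbasis zz galK phiM phiK psiK phic psic.
have Msat := rooted_in_saturated lP K zz.
apply/idP/idP; last exact: rooted_in_radical.
move=> wK; apply: contraT => nw.
have [|t tK []] := @gal_moves_over _ _ _ (kummer_ext sepF Msat) K
  (exist _ w wK : subfield K) _ galK nw.
  by move=> v; exact: rooted_in_radical.
suff -> : t = 1%g by [].
apply: (can_inj phiK); have -> : phi 1%g = 0.
  by apply: (addrI (phi 1%g)); rewrite -phiM mulg1 addr0.
apply/rowP => i; rewrite mxE.
have zK := zeta_kummer_system lP (in_subfield K) zz.
apply: (kchar_unique zK (er i) (ephi t i)).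
apply: (kcharP zK (mg_map_gal_io t)) => k; have [b xb] := er i k.
exists b => //; rewrite padic_res0 mulr0z raddf0 addr0.
apply: val_inj; apply: tK; apply: (@kummer_radical _ _ _ _ _ _
  (mg_map (@subfield_val _ _ _ K) b)).
by exists (e i), k; split; [exact: er|apply/kroot_subfield].
Qed.

End Correspondence.

Theorem theoremA1 (l : nat) (lP : prime l) (F : fieldType)
    (charF : l \notin [pchar F])
    (Fsep : fieldType) (iota : {rmorphism F -> Fsep})
    (sepF : separable_closure iota)
    (muF : mu_linfty Fsep l `<=` range iota) (d : nat) :
  exists f : subextension iota -> set (Vhat lP F),
    set_bij (Zld_extension iota lP d) (Grass d (Vhat lP F)) f.
Proof.
have [z zz] := zeta_system_exists lP charF sepF muF.
have td := mulgroup_torsion_div lP iota zz.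
exists (fun K => lattice_span (rooted_in (lP := lP) K)).
have sat (K : subextension iota) := rooted_in_saturated lP K zz.
split.
- move=> K [galK [phi [psi [phiM phiK psiK phic psic]]]].
  have [e eb _] := Zld_zbasis zz galK phiM phiK psiK phic psic.
  exact: (Grass_lattice_span td (sat K) eb).
- move=> K K'; rewrite !inE => ZK ZK' eKK'.
  have eM : rooted_in (lP := lP) K = rooted_in (lP := lP) K'.
    apply/seteqP; split=> x; rewrite -!(lattice_span_unit td) //.
      by rewrite eKK'.
    by rewrite eKK'.
  apply: subextension_eq => w.
  by rewrite (Zld_kummer zz sepF ZK) (Zld_kummer zz sepF ZK') eM.
- move=> W WG; have Msat := lattice_saturated WG.
  have [e eb] := lattice_zbasis td WG.
  have ZK := kummer_ext_Zld charF sepF zz Msat eb.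
  exists (kummer_ext sepF Msat) => //.
  have [galK [phi [psi [phiM phiK psiK phic psic]]]] := ZK.
  have [e' eb' _] := Zld_zbasis zz galK phiM phiK psiK phic psic.
  apply/esym/(Grass_sub_eq WG (Grass_lattice_span td (sat _) eb')).
  rewrite {1}(lattice_spanE WG) => v [D [x [D0 Mx e_v]]].
  exists D, x; split=> //; exact: kummer_rooted.
Qed.
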